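(* Let $G$ be a Cohen-Macaulay bipartite graph with a Macaulay order on the vertex set $V(G)=V\cup W$, where $V=\{x_1,\dots,x_d\}$ and $W=\{y_1,\dots,y_d\}$. Let $n_1,\dots,n_d$ be any positive integers with $n_i\ge 2$ for at least one $i$. Let $G'=G(n_1,\dots,n_d)$ be the graph obtained by replacing each edge $x_iy_i$ with the complete bipartite graph $K_{n_i,n_i}$ for all $i=1,\dots,d$. Let $n_{i_0}=\min\{n_i>1 : i=1,\dots,d\}$ and $n=\sum_{i=1}^d n_i$. Then $G'$ is exclusively a $\mathrm{CM}_{n-n_{i_0}+1}$ graph, that is, $G'$ is $\mathrm{CM}_{n-n_{i_0}+1}$ but not $\mathrm{CM}_{n-n_{i_0}}$. Furthermore, any bipartite $\mathrm{CM}_t$ graph which is not Cohen-Macaulay is obtained by such a replacement of complete bipartite graphs (with positive integers $n_i$, at least one of which is $\ge 2$) in a unique bipartite Cohen-Macaulay graph.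
   Context: All graphs are finite and simple; Cohen-Macaulayness of simplicial complexes is over a fixed field. The independence complex $\mathrm{Ind}(G)$ of a graph $G$ is the simplicial complex on the vertex set of $G$ whose faces are the independent sets of vertices. For an integer $t\ge 0$, a simplicial complex $\Delta$ is $\mathrm{CM}_t$ if it is pure and $\mathrm{link}_\Delta(F)$ is Cohen-Macaulay for every face $F\in\Delta$ with $\#F\ge t$. A graph $G$ is $\mathrm{CM}_t$ (respectively Cohen-Macaulay) if $\mathrm{Ind}(G)$ is $\mathrm{CM}_t$ (respectively Cohen-Macaulay, which is the same as $\mathrm{CM}_0$). A pure order of a bipartite graph is a labelled partition $\{x_1,\dots,x_d\},\{y_1,\dots,y_d\}$ of its vertex set, all edges joining the $x$-side to the $y$-side, such that (1) $x_iy_i$ is an edge for every $i$, and (2) whenever $x_iy_j$ and $x_jy_k$ are edges for distinct $i,j,k$, $x_iy_k$ is an edge. A Macaulay order is a pure order such that, in addition, $x_iy_j$ being an edge implies $i\le j$. Given a bipartite graph $G$ with pure order $(\{x_1,\dots,x_d\},\{y_1,\dots,y_d\})$ and positive integers $n_1,\dots,n_d$, the graph $G(n_1,\dots,n_d)$ obtained by replacing each edge $x_iy_i$ with the complete bipartite graph $K_{n_i,n_i}$ on $\{x_{i1},\dots,x_{in_i}\}$ and $\{y_{i1},\dots,y_{in_i}\}$, preserving all adjacencies, is the bipartite graph with vertices $x_{ir},y_{ir}$ ($1\le i\le d$, $1\le r\le n_i$) whose edges are exactly the pairs $x_{ir}y_{js}$ for which $x_iy_j$ is an edge of $G$ (in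 particular every $x_{ir}y_{is}$ is an edge).
   Formalization: In the ''Furthermore'' part the bipartite CM_t graph is also assumed to have no isolated vertices; otherwise the claim fails (K_{2,2} plus an isolated vertex), since a graph G(n_1,…,n_d) never has an isolated vertex. *)

(* Defs.v *)
From HB Require Import structures.
From mathcomp Require Import all_boot all_order all_algebra.
From mathcomp Require Import mpoly.

Set Implicit Arguments.
Unset Strict Implicit.
Unset Printing Implicit Defensive.

Import GRing.Theory.
Local Open Scope ring_scope.

Record sgraph := SGraph {
  vertex :> finType;
  adj : rel vertex;
  adj_sym : ssrbool.symmetric adj;
  adj_irr : irreflexive adj
}.

Definition graph_iso (G H : sgraph) : Prop :=
  exists f : G -> H, bijective f /\ forall u v, adj (f u) (f v) = adj u v.

Definition bipartite (G : sgraph) : Prop :=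
  exists A : {set G}, forall u v, adj u v -> (u \in A) != (v \in A).

Definition no_isolated (G : sgraph) : Prop :=
  forall u : G, exists v, adj u v.

Definition pure_order (G : sgraph) (d : nat) (x y : 'I_d -> G) : Prop :=
  [/\ bijective (fun u : 'I_d + 'I_d =>
        match u with inl i => x i | inr i => y i end),
      forall i j, ~~ adj (x i) (x j) /\ ~~ adj (y i) (y j),
      forall i, adj (x i) (y i)
    & forall i j k, i != j -> j != k -> i != k ->
        adj (x i) (y j) -> adj (x j) (y k) -> adj (x i) (y k)].

Definition macaulay_order (G : sgraph) (d : nat) (x y : 'I_d -> G) : Prop :=
  pure_order x y /\ forall i j, adj (x i) (y j) -> (i <= j)%N.

(* The graph G(n_1, ..., n_d): inl (i, r) is x_{ir} and inr (i, r) is y_{ir},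
   for r < n i. *)
Section Blowup.
Variables (G : sgraph) (d : nat) (x y : 'I_d -> G) (n : 'I_d -> nat).

Definition blowup_vertex : finType :=
  ({i : 'I_d & 'I_(n i)} + {i : 'I_d & 'I_(n i)})%type.

Definition blowup_adj : rel blowup_vertex := fun u v =>
  match u, v with
  | inl a, inr b => adj (x (tag a)) (y (tag b))
  | inr b, inl a => adj (x (tag a)) (y (tag b))
  | _, _ => false
  end.

Lemma blowup_adj_sym : ssrbool.symmetric blowup_adj.
Proof. by move=> [a|a] [b|b]. Qed.

Lemma blowup_adj_irr : irreflexive blowup_adj.
Proof. by move=> [a|a]. Qed.

Definition blowup : sgraph := SGraph blowup_adj_sym blowup_adj_irr.
End Blowup.

(* Simplicial complexes on a finite type, given by their set of faces.  The
   points of T that are not vertices of the complex are allowed: a link is a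
   complex on the same T. *)

Section Complexes.
Variable T : finType.
Implicit Types (D : {set {set T}}) (F : {set T}).

Definition facets D : {set {set T}} :=
  [set F : {set T} | maxset (fun E : {set T} => E \in D) F].

Definition pure D : Prop :=
  forall E F, E \in facets D -> F \in facets D -> #|E| = #|F|.

Definition link D F : {set {set T}} :=
  [set E : {set T} | [disjoint E & F] && (E :|: F \in D)].

(* One plus the dimension of D, which is the Krull dimension of its
   Stanley-Reisner ring. *)
Definition sc_rank D : nat := \max_(F in D) #|F|.
End Complexes.

Definition Ind (G : sgraph) : {set {set G}} :=
  [set F : {set G} | [forall u in F, forall v in F, ~~ adj u v]].

(* The quotient k[D] = S / I_D, where
   S = k[x_v : v in T], is handled through membership in ideals of S that
   contain I_D. *)

Definition in_ideal (R : comNzRingType) (s : seq R) (f : R) : Prop :=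
  exists c : nat -> R, f = \sum_(i < size s) c i * s`_i.

Section StanleyReisner.
Variables (k : fieldType) (T : finType) (D : {set {set T}}).
Local Notation S := {mpoly k[#|T|]}.

Definition set_monomial (F : {set T}) : S :=
  \prod_(v in F) 'X_(enum_rank v).

(* Generators of I_D; a point of T that is not a vertex of D contributes its
   variable. *)
Definition sr_gens : seq S := [seq set_monomial F | F <- enum (~: D)].

Definition homogeneous_seq (theta : seq S) : Prop :=
  forall f, f \in theta -> exists2 e : nat, (0 < e)%N & f \is e.-homog.

(* k[D] / (theta) has finite dimension over k. *)
Definition finite_quotient (theta : seq S) : Prop :=
  exists b : seq S, forall f : S, exists c : nat -> k,
    in_ideal (sr_gens ++ theta) (f - \sum_(i < size b) c i *: b`_i).

Definition hsop (theta : seq S) : Prop :=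
  [/\ size theta = sc_rank D, homogeneous_seq theta & finite_quotient theta].

Definition regular_seq (theta : seq S) : Prop :=
  (forall j, (j < size theta)%N -> forall f : S,
     in_ideal (sr_gens ++ take j theta) (theta`_j * f) ->
     in_ideal (sr_gens ++ take j theta) f)
  /\ ~ in_ideal (sr_gens ++ theta) 1.

(* k[D] is a Cohen-Macaulay graded ring: some homogeneous system of parameters
   is a regular sequence. *)
Definition cohen_macaulay : Prop :=
  exists theta : seq S, hsop theta /\ regular_seq theta.
End StanleyReisner.

Definition CMt (k : fieldType) (t : nat) (T : finType) (D : {set {set T}})
    : Prop :=
  pure D /\
  forall F : {set T}, F \in D -> (t <= #|F|)%N -> cohen_macaulay k (link D F).

Definition graph_CMt (k : fieldType) (t : nat) (G : sgraph) : Prop :=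
  CMt k t (Ind G).

Definition graph_CM (k : fieldType) (G : sgraph) : Prop :=
  cohen_macaulay k (Ind G).

(* G is, up to isomorphism, H(n_1, ..., n_d) for some Macaulay order of H and
   positive integers n_i, at least one of which is at least 2. *)
Definition obtained_by_replacement (G H : sgraph) : Prop :=
  exists (d : nat) (x y : 'I_d -> H) (n : 'I_d -> nat),
    [/\ macaulay_order x y, forall i, (0 < n i)%N, exists i, (2 <= n i)%N
      & graph_iso G (blowup x y n)].

(* Main.v *)
(** Write theta_j = X_(p j) - X_(q j) for the pairs (p j, q j) of a pure order.

    Cohen-Macaulayness.  If theta is weakly regular modulo I : x and modulo
    I + (x), then it is weakly regular modulo I.  For a face ideal and a vertex
    x these two ideals are the face ideals of the star and of the deletion of x.
    Removing the vertices p i, with i minimal among the pairs that still have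
    both vertices, leads to a complex in which each pair has lost one vertex
    and the other is a cone point; there theta_j is a variable up to sign.
    Since p_j q_j is an edge, squares of variables vanish modulo theta, so
    theta is also a system of parameters.  This settles graphs with a Macaulay
    order, and the links of large faces of their blow-ups.

    Failure for smaller faces.  The face made of all y_j with j < i0 and all x_j
    with j > i0 has as link two disjoint simplices on n_i0 vertices each.  If
    (t, t', ...) were regular on it, with restrictions a, a' of t, t' to the
    first simplex, then t' a = a' t forces a = u t, hence u = 1 on the first
    simplex and u = 0 on the second, although they share the constant term.

    Converse.  Only purity is used.  It gives Hall's condition between the two
    sides, and the transitivity of R i j := "x_i y_j is an edge".  The quotient
    of the preorder R by its equivalence relation is a poset; listing its classes
    by the size of the down-sets gives the Macaulay order of H.  A graph with a
    Macaulay order has no two vertices with the same neighbours, so any two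
    choices of H embed into each other. *)
Require Import Defs.
From HB Require Import structures.
From mathcomp Require Import all_boot all_order all_algebra.
From mathcomp Require Import mpoly.
From mathcomp Require Import ring zify.

Set Implicit Arguments.
Unset Strict Implicit.
Unset Printing Implicit Defensive.

Import GRing.Theory.

(** * Ideals and weakly regular sequences *)

Section Ideals.
Local Open Scope ring_scope.
Variable R : comNzRingType.
Implicit Types (I J : R -> Prop) (f g x t : R) (s : seq R).

Record is_ideal I : Prop := IsIdeal {
  ideal0 : I 0;
  idealD : forall f g, I f -> I g -> I (f + g);
  idealM : forall c f, I f -> I (c * f)
}.

Definition ideal_adjoin I x : R -> Prop := fun f => exists c, I (f - c * x).
Definition ideal_colon I x : R -> Prop := fun f => I (x * f).

Lemma idealN I f : is_ideal I -> I f -> I (- f).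
Proof. by move=> idI If; rewrite -mulN1r; apply: idealM. Qed.

Lemma idealB I f g : is_ideal I -> I f -> I g -> I (f - g).
Proof. by move=> idI If Ig; apply: idealD => //; apply: idealN. Qed.

Lemma ideal_subK I f g : is_ideal I -> I (f - g) -> I g -> I f.
Proof. by move=> idI Ifg Ig; rewrite -(subrK g f); apply: idealD. Qed.

Lemma ideal_sum I (A : eqType) (r : seq A) (F : A -> R) : is_ideal I ->
  (forall a, a \in r -> I (F a)) -> I (\sum_(a <- r) F a).
Proof.
move=> idI IF; rewrite big_seq; apply: big_ind => //.
- exact: ideal0 idI.
- exact: idealD idI.
Qed.

Lemma ideal_adjoin_ideal I x : is_ideal I -> is_ideal (ideal_adjoin I x).
Proof.
move=> idI; split.
- by exists 0; rewrite mul0r subr0; apply: ideal0.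
- move=> f g [a Ha] [b Hb]; exists (a + b).
  by rewrite (_ : _ - _ = f - a * x + (g - b * x)); [apply: idealD | ring].
- move=> c f [a Ha]; exists (c * a).
  by rewrite (_ : _ - _ = c * (f - a * x)); [apply: idealM | ring].
Qed.

Lemma ideal_adjoin_sub I x f : is_ideal I -> I f -> ideal_adjoin I x f.
Proof. by exists 0; rewrite mul0r subr0. Qed.

Lemma ideal_adjoin_gen I x c : is_ideal I -> ideal_adjoin I x (c * x).
Proof. by exists c; rewrite subrr; apply: ideal0. Qed.

(** Nonzero quotient is not part of this notion, so it passes along exact sequences of ideals;
    properness is proved separately in [cohen_macaulay_paired]. *)
Fixpoint weakly_regular I s : Prop :=
  if s is t :: s' then
    (forall f, I (t * f) -> I f) /\ weakly_regular (ideal_adjoin I t) s'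
  else True.

Lemma weakly_regular_ext I J s : (forall f, I f <-> J f) ->
  weakly_regular I s -> weakly_regular J s.
Proof.
elim: s I J => //= t s IHs I J eIJ [reg_t reg_s]; split.
  by move=> f /eIJ/reg_t/eIJ.
by apply: IHs reg_s => f; split=> -[c /eIJ]; exists c.
Qed.

(* The exact sequence 0 -> R/(I : x) -> R/I -> R/(I + x) -> 0, for ideals. *)
Lemma weakly_regular_exact I x s : is_ideal I ->
  weakly_regular (ideal_colon I x) s -> weakly_regular (ideal_adjoin I x) s ->
  weakly_regular I s.
Proof.
elim: s I => //= t s IHs I idI [regC1 regC] [regA1 regA]; split.
  (* Regularity modulo [I + (x)] makes [f] congruent to [g * x] modulo [I]; then [x * (t * g)] lies
     in [I], and regularity modulo the colon ideal applies to [g]. *)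
  move=> f Itf; have [g Ig] : ideal_adjoin I x f.
    by apply: regA1; apply: ideal_adjoin_sub.
  apply: (ideal_subK idI Ig); rewrite mulrC; apply: regC1; rewrite /ideal_colon.
  rewrite (_ : _ * _ = t * f - t * (f - g * x)); last by ring.
  by apply: idealB => //; apply: idealM.
apply: IHs; first exact: ideal_adjoin_ideal.
- apply: weakly_regular_ext regC => f; split=> -[c Ic].
    by exists (c * x); rewrite (_ : _ - _ = x * (f - c * t)) //; ring.
  (* The inclusion of the colon of [I + (t)] by [x] in [(I : x) + (t)] is the one that uses
     regularity of [t] modulo [I + (x)]: as [t * c] lies there, so does [c]. *)
  have [g Ig] : ideal_adjoin I x c.
    apply: regA1; exists f.
    by rewrite (_ : _ - _ = - (x * f - c * t)); [apply: idealN | ring].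
  exists g; rewrite /ideal_colon.
  rewrite (_ : _ * _ = x * f - c * t + t * (c - g * x)); last by ring.
  by apply: idealD => //; apply: idealM.
- apply: weakly_regular_ext regA => f; split=> -[c [b Ib]]; exists b, c;
  by move: Ib; congr I; ring.
Qed.

Lemma in_ideal_ideal s : is_ideal (in_ideal s).
Proof.
split.
- by exists (fun=> 0); rewrite big1 // => i _; rewrite mul0r.
- move=> f g [a ->] [b ->]; exists (fun i => a i + b i).
  by rewrite -big_split; apply: eq_bigr => i _; rewrite /= mulrDl.
- move=> c f [a ->]; exists (fun i => c * a i).
  by rewrite mulr_sumr; apply: eq_bigr => i _; rewrite mulrA.
Qed.

Lemma in_ideal_gen s f : f \in s -> in_ideal s f.
Proof.
move=> sf; exists (fun i => (i == index f s)%:R).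
have lt_i : (index f s < size s)%N by rewrite index_mem.
rewrite (bigD1 (Ordinal lt_i)) //= eqxx mul1r nth_index // big1 ?addr0 //.
by move=> i; rewrite -val_eqE /= => /negPf->; rewrite mul0r.
Qed.

Lemma in_ideal_min I s f : is_ideal I -> (forall g, g \in s -> I g) ->
  in_ideal s f -> I f.
Proof.
move=> idI sI [c ->]; apply: big_ind; first exact: ideal0.
- exact: idealD.
- by move=> i _; apply: idealM => //; apply/sI/mem_nth.
Qed.

Lemma in_ideal_sub s s' f : {subset s <= s'} -> in_ideal s f -> in_ideal s' f.
Proof.
move=> ss'; apply: in_ideal_min; first exact: in_ideal_ideal.
by move=> g /ss'; apply: in_ideal_gen.
Qed.

Lemma in_ideal_rcons s t f :
  in_ideal (rcons s t) f <-> ideal_adjoin (in_ideal s) t f.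
Proof.
have idr := in_ideal_ideal (rcons s t).
split.
- apply: in_ideal_min; first by apply: ideal_adjoin_ideal; apply: in_ideal_ideal.
  move=> g; rewrite mem_rcons inE => /predU1P[->|sg].
    by rewrite -{2}[t]mul1r; apply: ideal_adjoin_gen; apply: in_ideal_ideal.
  by apply: ideal_adjoin_sub; [apply: in_ideal_ideal | apply: in_ideal_gen].
- case=> c Ic; apply: (ideal_subK idr (g := c * t)).
    by apply: in_ideal_sub Ic => g sg; rewrite mem_rcons inE sg orbT.
  by apply: idealM => //; apply: in_ideal_gen; rewrite mem_rcons mem_head.
Qed.

Lemma weakly_regular_in_ideal s theta :
  weakly_regular (in_ideal s) theta ->
  forall j, (j < size theta)%N -> forall f : R,
    in_ideal (s ++ take j theta) (theta`_j * f) ->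
    in_ideal (s ++ take j theta) f.
Proof.
elim: theta s => //= t theta IHt s [reg_t reg] [_|j ltj] f /=.
  by rewrite cats0; apply: reg_t.
rewrite -cat_rcons; apply: IHt => //.
by apply: weakly_regular_ext reg => g; split => /in_ideal_rcons.
Qed.
End Ideals.

(** * Face ideals *)

Section FaceIdeals.
Local Open Scope ring_scope.
Variables (k : fieldType) (T : finType).
Implicit Types (D : {set {set T}}) (F E U : {set T}) (v w : T).
Local Notation S := {mpoly k[#|T|]}.
Implicit Types (f g : S) (m : 'X_{1..#|T|}).

Definition mnm_supp m : {set T} := [set v | m (enum_rank v) != 0%N].

(** The Stanley-Reisner ideal described by coefficients: every monomial that occurs has a nonface as
    support. [face_idealE] matches it with the generators when [D] is closed under subsets. *)
Definition face_ideal D f : Prop := forall m, mnm_supp m \in D -> f@_m = 0.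

Definition down_closed D : Prop :=
  forall E F, E \subset F -> F \in D -> E \in D.

Definition var v : S := 'X_(enum_rank v).

Lemma mnm_suppD m1 m2 : mnm_supp (m1 + m2) = mnm_supp m1 :|: mnm_supp m2.
Proof. by apply/setP=> v; rewrite !inE mnmDE addn_eq0 negb_and. Qed.

Lemma mnm_supp0 : mnm_supp 0%MM = set0.
Proof. by apply/setP=> v; rewrite !inE mnm0E. Qed.

Lemma mnm_supp1 v : mnm_supp U_(enum_rank v) = [set v].
Proof.
apply/setP=> w; rewrite !inE mnm1E (inj_eq enum_rank_inj) [v == w]eq_sym.
by case: (w == v).
Qed.

Lemma mnm_supp_le m v : v \in mnm_supp m -> (U_(enum_rank v) <= m)%MM.
Proof.
rewrite inE => mv; apply/mnm_lepP=> i; rewrite mnm1E.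
by case: eqP => // <-; rewrite lt0n.
Qed.

Definition set_mnm F : 'X_{1..#|T|} := (\sum_(v in F) U_(enum_rank v))%MM.

Lemma set_monomialE F : set_monomial k F = 'X_[set_mnm F].
Proof.
by rewrite /set_mnm (big_morph _ (@mpolyXD _ _) (@mpolyX0 _ _)).
Qed.

Lemma set_mnmE F v : set_mnm F (enum_rank v) = (v \in F) :> nat.
Proof.
rewrite /set_mnm mnm_sumE; have [Fv|nFv] := boolP (v \in F).
  rewrite (bigD1 v) //= mnm1E eqxx big1 // => w /andP[_ nwv].
  by rewrite mnm1E (inj_eq enum_rank_inj) (negPf nwv).
rewrite big1 // => w Fw; rewrite mnm1E (inj_eq enum_rank_inj).
by case: eqP => // e; rewrite e (negPf nFv) in Fw.
Qed.

Lemma mnm_supp_set F : mnm_supp (set_mnm F) = F.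
Proof. by apply/setP=> v; rewrite inE set_mnmE; case: (v \in F). Qed.

Lemma mnm_dvd m F : F \subset mnm_supp m ->
  (m = set_mnm F + (m - set_mnm F))%MM.
Proof.
move=> sF; rewrite addmC submK //; apply/mnm_lepP => i.
rewrite -(enum_valK i) set_mnmE; case Fi: (_ \in F) => //.
by have := subsetP sF _ Fi; rewrite inE lt0n.
Qed.

Lemma face_ideal_ideal D : down_closed D -> is_ideal (face_ideal D).
Proof.
move=> dcD; split.
- by move=> m _; rewrite mcoeff0.
- by move=> f g If Ig m Dm; rewrite mcoeffD If ?Ig ?addr0.
- move=> c f If m Dm; rewrite mcoeffM big1 // => -[m1 m2] /= /eqP em.
  rewrite If ?mulr0 //; apply: dcD Dm.
  by rewrite (congr1 mnm_supp em) mnm_suppD subsetUr.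
Qed.

Lemma face_idealX D m : mnm_supp m \notin D -> face_ideal D 'X_[m].
Proof.
by move=> nDm m' Dm'; rewrite mcoeffX; case: eqP Dm' => // <-; rewrite (negPf nDm).
Qed.

Lemma face_idealE D f : down_closed D ->
  face_ideal D f <-> in_ideal (sr_gens k D) f.
Proof.
move=> dcD; split; last first.
  apply: in_ideal_min; first exact: face_ideal_ideal.
  move=> _ /mapP[F + ->]; rewrite mem_enum inE => nDF.
  by rewrite set_monomialE; apply: face_idealX; rewrite mnm_supp_set.
have idI := in_ideal_ideal (sr_gens k D).
move=> If; rewrite [f]mpolyE; apply: ideal_sum => // m _.
have [Dm|nDm] := boolP (mnm_supp m \in D).
  by rewrite If // scale0r; apply: ideal0.
rewrite [X in 'X_[X]](mnm_dvd (subxx (mnm_supp m))) addmC mpolyXD scalerAl.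
rewrite -set_monomialE; apply: idealM => //; apply: in_ideal_gen.
by apply: map_f; rewrite mem_enum inE.
Qed.

Definition deletion D v := [set F in D | v \notin F].
Definition star D v := [set F | v |: F \in D].

Lemma deletion_down_closed D v : down_closed D -> down_closed (deletion D v).
Proof.
move=> dcD E F sEF; rewrite !inE => /andP[DF nFv]; rewrite (dcD _ _ sEF DF).
by apply: contra nFv => /(subsetP sEF).
Qed.

(** Multiplication by [var v] shifts exponents and adds [v] to each support, so the coefficient of
    [f] at [m] is constrained exactly when [v |: mnm_supp m] is a face. *)
Lemma face_ideal_colon D v f : down_closed D ->
  ideal_colon (face_ideal D) (var v) f <-> face_ideal (star D v) f.
Proof.
move=> dcD; rewrite /ideal_colon mulrC; split=> If m.
  rewrite inE => Dm; rewrite -(mcoeffMX f U_(enum_rank v)); apply: If.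
  by rewrite mnm_suppD mnm_supp1.
move=> Dm; have [mv|] := boolP (v \in mnm_supp m).
  have dm := mnm_supp_le mv.
  rewrite -(submK dm) addmC mcoeffMX If // inE.
  by rewrite -mnm_supp1 -mnm_suppD addmC submK.
move=> nmv; apply: memN_msupp_eq0; apply: contra nmv => /msuppM_le /allpairsP.
case=> -[m1 m2] /= [_ + ->]; rewrite msuppX inE => /eqP->.
by rewrite mnm_suppD mnm_supp1 inE set11 orbT.
Qed.

(** Sort the monomials of [f]: those divisible by [v] are absorbed by the new generator, and among
    the others only nonfaces of [D] can occur. *)
Lemma face_ideal_adjoin D v f : down_closed D ->
  ideal_adjoin (face_ideal D) (var v) f <-> face_ideal (deletion D v) f.
Proof.
move=> dcD; have idD := face_ideal_ideal dcD.
have idd := face_ideal_ideal (deletion_down_closed (v := v) dcD).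
split.
  case=> c Ic; apply: (ideal_subK idd (g := c * var v)).
    by move=> m; rewrite inE => /andP[Dm _]; apply: Ic.
  apply: (idealM idd); apply: face_idealX.
  by rewrite mnm_supp1 !inE eqxx andbF.
move=> If; have idA := ideal_adjoin_ideal (var v) idD.
rewrite [f]mpolyE; apply: ideal_sum => // m _.
have [mv|nmv] := boolP (v \in mnm_supp m).
  have dm := mnm_supp_le mv.
  rewrite -(submK dm) mpolyXD scalerAl; exact: ideal_adjoin_gen.
have [Dm|nDm] := boolP (mnm_supp m \in D).
  have -> : f@_m = 0 by apply: If; rewrite in_set Dm nmv.
  by rewrite scale0r; apply: (ideal0 idA).
apply: ideal_adjoin_sub => //; rewrite -mul_mpolyC; apply: (idealM idD).
exact: face_idealX.
Qed.

(** If all squares of variables vanish, the finitely many squarefree monomials span the quotient. *)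
Lemma finite_quotient_squarefree (D : {set {set T}}) (theta : seq S) :
  (forall v, in_ideal (sr_gens k D ++ theta) (var v * var v)) ->
  finite_quotient D theta.
Proof.
move=> sqK; have idK := in_ideal_ideal (sr_gens k D ++ theta).
exists [seq set_monomial k F | F <- index_enum {set T}] => f.
exists (fun i => f@_(set_mnm (nth set0 (index_enum {set T}) i))).
set g := _ - _.
(* Subtracting the squarefree part of [f] leaves only monomials divisible by the square of some
   variable. *)
have g0 F : g@_(set_mnm F) = 0.
  rewrite /g mcoeffB raddf_sum /=.
  have -> : \sum_(i < size [seq set_monomial k F | F <- index_enum {set T}])
      (f@_(set_mnm (nth set0 (index_enum {set T}) i)) *:
         [seq set_monomial k F | F <- index_enum {set T}]`_i)@_(set_mnm F)
      = \sum_(E : {set T}) f@_(set_mnm E) * (E == F)%:R.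
    rewrite size_map [RHS](big_nth set0) big_mkord.
    apply: eq_bigr => i _; rewrite (nth_map set0) // mcoeffZ set_monomialE mcoeffX.
    by congr (_ * (nat_of_bool _)%:R); apply: (inj_eq (can_inj mnm_supp_set)).
  rewrite (bigD1 F) //= eqxx mulr1 big1 ?addr0 ?subrr //.
  by move=> E /negPf->; rewrite mulr0.
rewrite [g]mpolyE; apply: ideal_sum => // m _; rewrite -mul_mpolyC.
have [e|/eqP/mnmP neq] := eqVneq m (set_mnm (mnm_supp m)).
  by rewrite [X in g@_X]e g0 mpolyC0 mul0r; apply: ideal0.
apply: (idealM idK).
have [v m_v|le1] := pickP (fun v => 1 < m (enum_rank v))%N.
  rewrite (_ : m = (m - (U_(enum_rank v) + U_(enum_rank v)) +
                    (U_(enum_rank v) + U_(enum_rank v))))%MM.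
    by rewrite !mpolyXD; apply: (idealM idK); apply: sqK.
  rewrite submK //; apply/mnm_lepP=> i; rewrite mnmDE !mnm1E.
  by case: eqP => // <-.
case: neq => i; rewrite -(enum_valK i) set_mnmE inE.
by have := le1 (enum_val i); rewrite /=; case: (m _) => [|[|]].
Qed.
End FaceIdeals.

(** * Independence complexes of paired graphs *)

Section InducedIndependence.
Variable G : sgraph.
Implicit Types (E F U : {set G}) (v w : G).

Lemma IndP F :
  reflect (forall u v, u \in F -> v \in F -> ~~ adj u v) (F \in Ind G).
Proof.
rewrite inE; apply: (iffP forall_inP) => [indF u v Fu Fv | indF u Fu].
  by have /forall_inP := indF u Fu; apply.
by apply/forall_inP=> v; apply: indF.
Qed.

Definition Ind_on U : {set {set G}} := [set E in Ind G | E \subset U].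

Lemma Ind_onP U E :
  reflect (E \subset U /\ forall u v, u \in E -> v \in E -> ~~ adj u v)
          (E \in Ind_on U).
Proof.
rewrite in_set; apply: (iffP andP) => [[/IndP]|[? ?]]; first by [].
by split=> //; apply/IndP.
Qed.

Lemma Ind_on_setT : Ind_on setT = Ind G.
Proof. by apply/setP=> E; rewrite in_set subsetT andbT. Qed.

Lemma Ind_on_down_closed U : down_closed (Ind_on U).
Proof.
move=> E F sEF /Ind_onP[sFU indF]; apply/Ind_onP.
split=> [|u v /(subsetP sEF)Fu /(subsetP sEF)]; last exact: indF.
exact: subset_trans sEF sFU.
Qed.

Lemma Ind_on_deletion U v : deletion (Ind_on U) v = Ind_on (U :\ v).
Proof.
apply/setP=> E; by rewrite !in_set subsetD1 andbA.
Qed.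

Lemma Ind_on_star U v : v \in U ->
  star (Ind_on U) v = Ind_on [set w in U | ~~ adj v w].
Proof.
move=> Uv; apply/setP=> E; rewrite in_set; apply/Ind_onP/Ind_onP.
  case=> sEU indE; split=> [|u w Eu Ew]; last by apply: indE; rewrite inE ?Eu ?Ew orbT.
  apply/subsetP=> w Ew; rewrite inE (subsetP sEU) ?inE ?Ew ?orbT //=.
  by apply: indE; rewrite !inE ?eqxx // Ew orbT.
case=> sEU indE; split.
  apply/subsetP=> w; rewrite !inE => /predU1P[-> //|/(subsetP sEU)].
  by rewrite inE => /andP[].
have nadj w : w \in E -> ~~ adj v w by move/(subsetP sEU); rewrite inE => /andP[].
move=> u w; rewrite !inE => /predU1P[->|Eu] /predU1P[->|Ew].
- by rewrite adj_irr.
- exact: nadj.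
- by rewrite adj_sym nadj.
- exact: indE.
Qed.

Lemma link_Ind F : F \in Ind G ->
  link (Ind G) F =
  Ind_on [set v | (v \notin F) && [forall u in F, ~~ adj u v]].
Proof.
move=> /IndP indF; apply/setP=> E; rewrite in_set; apply/andP/Ind_onP.
  case=> dEF /IndP indEF; split=> [|u v Eu Ev]; last first.
    by apply: indEF; rewrite inE ?Eu ?Ev.
  apply/subsetP=> v Ev; rewrite inE (disjointFr dEF Ev) /=.
  by apply/forall_inP=> u Fu; apply: indEF; rewrite inE ?Fu ?Ev ?orbT.
case=> sE indE.
have nadj u v : u \in E -> v \in F -> ~~ adj u v.
  move=> /(subsetP sE); rewrite inE => /andP[_ /forall_inP nF] Fv.
  by rewrite adj_sym nF.
split.
  apply/pred0P=> v /=; apply/negbTE/negP=> /andP[/(subsetP sE)].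
  by rewrite inE => /andP[/negPf->].
apply/IndP=> u v; rewrite !inE => /orP[Eu|Fu] /orP[Ev|Fv].
- exact: indE.
- exact: nadj.
- by rewrite adj_sym nadj.
- exact: indF.
Qed.
End InducedIndependence.

(** * Paired graphs: weak regularity, rank and Cohen-Macaulayness *)

Record pairing (G : sgraph) (J : finType) (p q : J -> G) : Prop := Pairing {
  pairing_injl : injective p;
  pairing_injr : injective q;
  pairing_neq : forall i j, p i != q j;
  pairing_adjll : forall i j, ~~ adj (p i) (p j);
  pairing_adjrr : forall i j, ~~ adj (q i) (q j);
  pairing_adj : forall j, adj (p j) (q j);
  pairing_trans : forall i j l,
    adj (p i) (q j) -> adj (p j) (q l) -> adj (p i) (q l)
}.

Section PairedGraph.
Local Open Scope ring_scope.
Variables (k : fieldType) (G : sgraph) (J : finType) (p q : J -> G).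
Hypothesis pq_pairing : pairing p q.

Let p_inj := pairing_injl pq_pairing.
Let q_inj := pairing_injr pq_pairing.
Let p_neq_q := pairing_neq pq_pairing.
Let adj_pp := pairing_adjll pq_pairing.
Let adj_qq := pairing_adjrr pq_pairing.
Let adj_pq := pairing_adj pq_pairing.
Let adj_trans := pairing_trans pq_pairing.

(* The links that occur: a vertex of U whose partner is not in U is isolated in
   the graph induced on U. *)
Record paired_set (U : {set G}) (r : J -> nat) : Prop := PairedSet {
  paired_cover : forall v, v \in U -> exists j, v = p j \/ v = q j;
  paired_alive : forall j, (p j \in U) || (q j \in U);
  paired_isolated : forall i j, p i \in U -> q j \in U -> adj (p i) (q j) ->
    (q i \in U) && (p j \in U);
  paired_order : forall i j, p i \in U -> q j \in U -> adj (p i) (q j) ->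
    i != j -> (r i < r j)%N
}.

Definition pair_form (j : J) : {mpoly k[#|G|]} := var k (p j) - var k (q j).

(** Modulo the ideal [w] is zero, so each form is a variable [v] up to sign. A cone point is a
    nonzerodivisor, and killing it deletes [v], which leaves the other cone points in place. *)
Lemma weakly_regular_cone (D : {set {set G}}) (s : seq J) :
  down_closed D -> uniq s ->
  (forall j, j \in s -> exists v w,
     [/\ (v, w) = (p j, q j) \/ (v, w) = (q j, p j),
         forall E, E \in D -> v |: E \in D & [set w] \notin D]) ->
  weakly_regular (face_ideal (k := k) D) [seq pair_form j | j <- s].
Proof.
elim: s D => //= j s IHs D dcD /andP[njs uniq_s] coneD.
have [v [w [vw cone_v Dw]]] := coneD j (mem_head _ _).
have idD := face_ideal_ideal k dcD.
have Iw : face_ideal D (var k w) by apply: face_idealX; rewrite mnm_supp1.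
have [c c2 fE] : exists2 c : {mpoly k[#|G|]}, c * c = 1 &
    pair_form j = c * (var k v - var k w).
  case: vw => -[-> ->]; first by exists 1; rewrite ?mul1r.
  by exists (-1); rewrite /pair_form; ring.
split=> [f|].
  move=> If; have /(face_ideal_colon _ _ dcD) Sf : face_ideal D (var k v * f).
    rewrite (_ : _ * _ = c * (pair_form j * f) + f * var k w).
      by apply: (idealD idD) => //; apply: (idealM idD).
    by rewrite fE !mulrA c2; ring.
  by move=> m Dm; apply: Sf; rewrite in_set; apply: cone_v.
apply: (weakly_regular_ext (I := face_ideal (deletion D v))) => [f|].
  split.
    case/(face_ideal_adjoin _ _ dcD) => a Ia; exists (c * a).
    rewrite (_ : _ - _ = f - a * var k v + a * var k w); last first.
      by rewrite fE (_ : c * a * _ = (c * c) * (a * (var k v - var k w)));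
        [rewrite c2; ring | ring].
    by apply: (idealD idD) => //; apply: (idealM idD).
  case=> a Ia; apply/(face_ideal_adjoin _ _ dcD); exists (c * a).
  rewrite (_ : _ - _ = f - a * pair_form j - (c * a) * var k w).
    by apply: (idealB idD) => //; apply: (idealM idD).
  by rewrite fE; ring.
apply: IHs => //; first exact: deletion_down_closed.
move=> i si; have [|v' [w' [vw' cone_v' Dw']]] := coneD i; first by rewrite inE si orbT.
exists v', w'; split=> //; last by rewrite in_set (negPf Dw').
move=> E; rewrite !in_set => /andP[DE nEv]; rewrite cone_v' //= !inE negb_or nEv andbT.
have neq_ij : i != j by apply: contraNneq njs => <-.
by case: vw vw' => -[-> _] [] [-> _];
  rewrite ?(inj_eq p_inj) ?(inj_eq q_inj) ?p_neq_q 1?[q j == _]eq_sym ?p_neq_q //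
    eq_sym ?p_neq_q.
Qed.

(** Induction on the number of pairs with both vertices in [U], through the exact sequence for [p i]
    with [i] minimal for [r] among them. The star and the deletion of [p i] both break pair [i] and
    are again paired sets. *)
Lemma weakly_regular_paired U r s : paired_set U r -> uniq s ->
  weakly_regular (face_ideal (k := k) (Ind_on U)) [seq pair_form j | j <- s].
Proof.
pose both (V : {set G}) := [set j | (p j \in V) && (q j \in V)].
move=> + uniq_s; move: {2}#|both U|.+1 (ltnSn #|both U|) => n.
elim: n U => // n IHn U ltUn PU.
have [_ pU iU oU] := PU.
have dcU := @Ind_on_down_closed G U.
have [i0 both_i0 | both0] := pickP (mem (both U)); last first.
  (* No complete pair is left: the surviving vertex of each pair is isolated in [U], hence a cone
     point, and its partner is not a vertex of the complex. *)
  apply: weakly_regular_cone => // j _.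
  have := both0 j; rewrite /= inE => pq_j.
  have [Upj|nUpj] := boolP (p j \in U).
    rewrite Upj /= in pq_j; exists (p j), (q j); split; first by left.
      move=> E; have -> : Ind_on U = star (Ind_on U) (p j).
        rewrite Ind_on_star //; congr Ind_on; apply/setP=> w; rewrite inE.
        have [Uw|//] := boolP (w \in U); apply/esym.
        have [i [?|?]] := paired_cover PU Uw; subst w; first exact: adj_pp.
        by apply/negP=> /(iU _ _ Upj Uw); rewrite pq_j.
      by rewrite !in_set setUA setUid.
    by apply/negP=> /Ind_onP[]; rewrite sub1set pq_j.
  have /orP[|Uqj] := pU j; first by rewrite (negPf nUpj).
  exists (q j), (p j); split; first by right.
    move=> E; have -> : Ind_on U = star (Ind_on U) (q j).
      rewrite Ind_on_star //; congr Ind_on; apply/setP=> w; rewrite inE.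
      have [Uw|//] := boolP (w \in U); apply/esym.
      have [i [?|?]] := paired_cover PU Uw; subst w; last exact: adj_qq.
      rewrite /= adj_sym; apply/negP=> /(iU _ _ Uw Uqj).
      by rewrite (negPf nUpj) andbF.
    by rewrite !in_set setUA setUid.
  by apply/negP=> /Ind_onP[]; rewrite sub1set (negPf nUpj).
case: (arg_minnP r both_i0) => i /= /[!inE] /andP[Upi Uqi] min_i.
have smaller (V : {set G}) : V \subset U -> i \notin both V -> (#|both V| < n)%N.
  move=> /subsetP sVU nVi; rewrite -ltnS; apply: leq_trans ltUn.
  rewrite ltnS; apply: proper_card; apply/properP; split; last first.
    by exists i; rewrite // inE Upi.
  by apply/subsetP=> j; rewrite !inE => /andP[/sVU-> /sVU->].
apply: (weakly_regular_exact (x := var k (p i))).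
- exact: face_ideal_ideal.
- apply: (weakly_regular_ext (I := face_ideal (star (Ind_on U) (p i)))).
    by move=> f; split=> /face_ideal_colon; apply.
  rewrite Ind_on_star //; apply: IHn.
    apply: smaller; last by rewrite !inE adj_pq !andbF.
    by apply/subsetP=> w; rewrite inE => /andP[].
  split=> [v|j|a b|a b].
  + by rewrite inE => /andP[Uv _]; apply: paired_cover PU _ Uv.
  + rewrite !inE adj_pp andbT.
    have [Upj|nUpj] := boolP (p j \in U); rewrite ?Upj //; have := pU j.
    rewrite (negPf nUpj) /=.
    move=> Uqj; rewrite Uqj; apply/negP=> /(iU _ _ Upi Uqj).
    by rewrite (negPf nUpj) andbF.
  + rewrite !inE => /andP[Upa _] /andP[Uqb nib] ab.
    have /andP[-> ->] := iU _ _ Upa Uqb ab; rewrite adj_pp /= andbT.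
    (* If the star lost [q a] as a neighbour of [p i], transitivity through [a] would make [q b] a
       neighbour of [p i] too. *)
    by apply: contra nib => /adj_trans; apply.
  + by rewrite !inE => /andP[Upa _] /andP[Uqb _]; apply: oU.
- apply: (weakly_regular_ext (I := face_ideal (deletion (Ind_on U) (p i)))).
    by move=> f; split=> /face_ideal_adjoin; apply.
  rewrite Ind_on_deletion; apply: IHn.
    by apply: smaller; [apply: subsetDl | rewrite !inE eqxx].
  split=> [v|j|a b|a b].
  + by rewrite !inE => /andP[_ Uv]; apply: paired_cover PU _ Uv.
  + rewrite !inE ![_ == p i]eq_sym p_neq_q /= (inj_eq p_inj).
    by case: eqP => [<-|_]; rewrite ?Uqi ?pU.
  + rewrite !inE ![q _ == _]eq_sym !p_neq_q /= => /andP[npa Upa] Uqb ab.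
    have /andP[-> ->] := iU _ _ Upa Uqb ab; rewrite andbT /= (inj_eq p_inj).
    (* Deleting [p i] could spoil isolation only through an edge from some other [p a] to [q i].
       Then pair [a] would be complete with a smaller [r], against the choice of [i]. *)
    apply/eqP=> b_i; subst b; rewrite (inj_eq p_inj) in npa.
    have := oU _ _ Upa Uqb ab npa; rewrite ltnNge min_i // inE Upa.
    by case/andP: (iU _ _ Upa Uqb ab) => ->.
  + by rewrite !inE => /andP[_ Upa] /andP[_ Uqb]; apply: oU.
Qed.

(** An independent set holds at most one vertex of each pair. Equality is reached by taking [q j]
    whenever it is in [U] and [p j] otherwise: a chosen [p j] has no partner in [U], so it is
    isolated. *)
Lemma sc_rank_paired U r : paired_set U r -> sc_rank (Ind_on U) = #|J|.
Proof.
case=> cU pU iU _; apply/eqP; rewrite eqn_leq; apply/andP; split.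
  apply/bigmax_leqP=> E /Ind_onP[/subsetP sEU indE].
  apply: leq_trans (leq_imset_card (fun j => if p j \in E then p j else q j) J).
  apply/subset_leq_card/subsetP=> v Ev; apply/imsetP.
  have [j [e|e]] := cU _ (sEU _ Ev); exists j => //; rewrite -e ?Ev //.
  by case: ifP => // Epj; have := indE _ _ Epj Ev; rewrite e adj_pq.
pose h j := if q j \in U then q j else p j.
have h_inj : injective h.
  move=> i j; rewrite /h; case: ifP => _; case: ifP => _.
  - exact: q_inj.
  - by move/esym/eqP; rewrite (negPf (p_neq_q _ _)).
  - by move/eqP; rewrite (negPf (p_neq_q _ _)).
  - exact: p_inj.
rewrite -cardsT -(card_imset _ h_inj).
apply: (leq_bigmax_cond (F := fun E : {set G} => #|E|)).
have Uh j : h j \in U.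
  by rewrite /h; case: ifPn => // nUq; have := pU j; rewrite (negPf nUq) orbF.
apply/Ind_onP; split; first by apply/subsetP=> _ /imsetP[j _ ->].
move=> _ _ /imsetP[i _ ->] /imsetP[j _ ->]; move: (Uh i) (Uh j); rewrite /h.
case: ifP => Uqi; case: ifP => Uqj Ui Uj.
- exact: adj_qq.
- by rewrite adj_sym; apply/negP=> /(iU _ _ Uj Ui); rewrite Uqj.
- by apply/negP=> /(iU _ _ Ui Uj); rewrite Uqi.
- exact: adj_pp.
Qed.

Lemma cohen_macaulay_paired U r :
  paired_set U r -> cohen_macaulay k (Ind_on U).
Proof.
move=> PU; have [cU pU iU oU] := PU.
have dcU := @Ind_on_down_closed G U.
exists [seq pair_form j | j <- enum J].
have U0 : set0 \in Ind_on U.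
  by apply/Ind_onP; split=> [|u v]; rewrite ?sub0set ?inE.
split; [split | split].
- by rewrite size_map -cardE (sc_rank_paired PU).
- move=> _ /mapP[j _ ->]; exists 1%N => //.
  by rewrite /pair_form rpredB // dhomogX /= mdeg1.
- apply: finite_quotient_squarefree; set K := in_ideal _.
  have idK : is_ideal K := in_ideal_ideal _.
  have DK f : face_ideal (Ind_on U) f -> K f.
    move/(face_idealE _ dcU); apply: in_ideal_sub => g.
    by rewrite mem_cat => ->.
  have thetaK j : K (pair_form j).
    by apply: in_ideal_gen; rewrite mem_cat map_f ?orbT // mem_enum.
  have pqK j : K (var k (p j) * var k (q j)).
    apply: DK; rewrite /var -mpolyXD; apply: face_idealX.
    rewrite mnm_suppD !mnm_supp1; apply/negP=> /Ind_onP[_].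
    move/(_ (p j) (q j)); rewrite !inE !eqxx orbT adj_pq.
    by move=> /(_ isT isT).
  move=> v; have [Uv|nUv] := boolP (v \in U); last first.
    apply: (idealM idK); apply/DK/face_idealX; rewrite mnm_supp1.
    by apply/negP=> /Ind_onP[]; rewrite sub1set (negPf nUv).
  (* The square of [p j] is [p j] times the form plus the edge monomial of [p j] and [q j];
     symmetrically, up to sign, for [q j]. *)
  have [j [->|->]] := cU _ Uv.
    rewrite (_ : _ * _ = var k (p j) * pair_form j + var k (p j) * var k (q j)).
      by apply: (idealD idK) => //; apply: (idealM idK).
    by rewrite /pair_form; ring.
  rewrite (_ : _ * _ = (- var k (q j)) * pair_form j + var k (p j) * var k (q j)).
    by apply: (idealD idK) => //; apply: (idealM idK).
  by rewrite /pair_form; ring.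
- apply: weakly_regular_in_ideal.
  apply: (weakly_regular_ext (I := face_ideal (Ind_on U))).
    by move=> f; apply: face_idealE.
  exact: weakly_regular_paired PU (enum_uniq _).
(* The face ideal of the complex with the empty face only consists of the polynomials without
   constant term. It contains all generators and all forms but not 1. *)
- pose D0 : {set {set G}} := [set set0].
  have dc0 : down_closed D0.
    by move=> E F sEF; rewrite !inE => /eqP eF; rewrite eF subset0 in sEF.
  have id0 := face_ideal_ideal k dc0.
  have var0 v : face_ideal D0 (var k v).
    by apply: face_idealX; rewrite mnm_supp1 inE -cards_eq0 cards1.
  move/(in_ideal_min id0) => one0.
  have /eqP : (1 : {mpoly k[#|G|]})@_0%MM = 0.
    apply: one0; last by rewrite mnm_supp0 inE.
    move=> g; rewrite mem_cat => /orP[]/mapP[].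
      move=> F; rewrite mem_enum inE => nF ->; rewrite set_monomialE.
      apply: face_idealX; rewrite mnm_supp_set inE.
      by apply: contraNneq nF => ->.
    by move=> j _ ->; apply: (idealB id0).
  by rewrite mcoeff1 eqxx oner_eq0.
Qed.

(** A facet meets each pair exactly once. If it missed pair [j], maximality would supply a neighbour
    of [p j] and one of [q j] in [F], and transitivity through [j] would join these two. *)
Lemma card_facet_paired F : (forall v, exists j, v = p j \/ v = q j) ->
  F \in facets (Ind G) -> #|F| = #|J|.
Proof.
move=> cover; rewrite in_set => /maxsetP[/IndP indF maxF].
have blocked v : v \notin F -> exists2 w, w \in F & adj v w.
  move=> nFv; apply/exists_inP; apply: contraNT nFv => /exists_inPn nadj.
  rewrite -(maxF (v |: F)) ?setU11 ?subsetUr //; apply/IndP=> a b.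
  rewrite !inE => /predU1P[->|Fa] /predU1P[->|Fb].
  - by rewrite adj_irr.
  - exact: nadj.
  - by rewrite adj_sym nadj.
  - exact: indF.
pose h j := if p j \in F then p j else q j.
have h_inj : injective h.
  move=> i j; rewrite /h; case: ifP => _; case: ifP => _.
  - exact: p_inj.
  - by move/eqP; rewrite (negPf (p_neq_q _ _)).
  - by move/esym/eqP; rewrite (negPf (p_neq_q _ _)).
  - exact: q_inj.
rewrite -cardsT -(card_imset _ h_inj); apply: eq_card => v.
apply/idP/imsetP=> [Fv|[j _ ->]].
  have [j [e|e]] := cover v; exists j => //; rewrite /h -e ?Fv //.
  by case: ifP => // Fpj; have := indF _ _ Fpj Fv; rewrite e adj_pq.
rewrite /h; case: ifP => // nFp; apply/idPn=> nFq.
have [w Fw pw] := blocked _ (negbT nFp); have [u Fu qu] := blocked _ nFq.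
have [i [e|e]] := cover w; first by rewrite e (negPf (adj_pp _ _)) in pw.
have [l [e'|e']] := cover u; last by rewrite e' (negPf (adj_qq _ _)) in qu.
have := indF _ _ Fu Fw; rewrite e e' (adj_trans (j := j)) -?e //.
by rewrite -e' adj_sym.
Qed.
End PairedGraph.

(** * Two disjoint simplices *)

Section DisjointSimplices.
Local Open Scope ring_scope.
Variables (k : fieldType) (T : finType).
Local Notation S := {mpoly k[#|T|]}.
Implicit Types (f g : S) (X Y : {set T}).

(** The retraction onto the polynomial ring in the variables of [X]; its kernel is the face ideal of
    the full simplex on [X]. *)
Definition restr X : S -> S :=
  comp_mpoly [tuple if enum_val i \in X then 'X_i else 0 | i < #|T|].

HB.instance Definition _ X := GRing.RMorphism.on (restr X).

Lemma restrX X m :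
  restr X 'X_[m] = if mnm_supp m \subset X then 'X_[m] else 0.
Proof.
rewrite /restr comp_mpolyX; case: ifPn => [/subsetP sX|/subsetPn[v mv nXv]].
  rewrite [RHS]mpolyXE_id; apply: eq_bigr => i _; rewrite tnth_mktuple.
  case: ifPn => // nXi; have : enum_val i \notin mnm_supp m.
    by apply: contra nXi => /sX.
  by rewrite inE enum_valK negbK => /eqP->; rewrite !expr0.
rewrite (bigD1 (enum_rank v)) //= tnth_mktuple enum_rankK (negPf nXv).
by rewrite expr0n; move: mv; rewrite inE => /negPf->; rewrite mul0r.
Qed.

Lemma mcoeff_restr X f m :
  (restr X f)@_m = if mnm_supp m \subset X then f@_m else 0.
Proof.
rewrite {1}[f]mpolyE rmorph_sum /= raddf_sum /=.
transitivity (\sum_(m' <- msupp f)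
    (if mnm_supp m \subset X then (f@_m' *: 'X_[m'])@_m else 0)).
  apply: eq_bigr => m' _.
  rewrite -mul_mpolyC rmorphM /= {1}/restr comp_mpolyC restrX.
  rewrite !mcoeffCM mcoeffX; have [<-|ne] := eqVneq m' m.
    by case: ifP => _; rewrite ?mcoeffX ?mcoeff0 ?eqxx ?mulr0.
  by rewrite !mulr0 if_same; case: ifP => _;
    rewrite ?mcoeffX ?mcoeff0 ?(negPf ne) mulr0.
case: ifP => _; last by rewrite big1.
by rewrite [in RHS](mpolyE f) raddf_sum.
Qed.

Lemma not_cohen_macaulay_disjoint_simplices (D : {set {set T}}) X Y :
  (forall E, (E \in D) = (E \subset X) || (E \subset Y)) ->
  [disjoint X & Y] -> (1 < #|X|)%N -> (0 < #|Y|)%N -> ~ cohen_macaulay k D.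
Proof.
move=> DE dXY X2 Y1 [theta [[sz_theta hom_theta _] [reg_theta _]]].
have dcD : down_closed D.
  by move=> E F sEF; rewrite !DE => /orP[]/(subset_trans sEF)->; rewrite ?orbT.
have idD := face_ideal_ideal k dcD.
(* With [faceX] and [faceY] below, this presents the face ideal as the intersection of the kernels
   of the two restrictions. *)
have faceE f : restr X f = 0 -> restr Y f = 0 -> face_ideal D f.
  move=> fX fY m; rewrite DE => /orP[] sm.
    by have := mcoeff_restr X f m; rewrite sm fX mcoeff0.
  by have := mcoeff_restr Y f m; rewrite sm fY mcoeff0.
have faceX f : face_ideal D f -> restr X f = 0.
  move=> If; apply/mpolyP=> m; rewrite mcoeff_restr mcoeff0.
  by case: ifP => // sm; apply: If; rewrite DE sm.
have faceY f : face_ideal D f -> restr Y f = 0.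
  move=> If; apply/mpolyP=> m; rewrite mcoeff_restr mcoeff0.
  by case: ifP => // sm; apply: If; rewrite DE sm orbT.
have restr_disj (X' Y' : {set T}) f : [disjoint X' & Y'] -> f@_0%MM = 0 ->
    restr Y' (restr X' f) = 0.
  move=> dXY' f0; apply/mpolyP=> m; rewrite !mcoeff_restr mcoeff0.
  case: ifP => // sY; case: ifP => // sX.
  suff -> : m = 0%MM by [].
  have m0 : mnm_supp m = set0.
    apply/setP=> v; rewrite [RHS]inE; apply/negP=> mv.
    by have := disjointFr dXY' (subsetP sX _ mv); rewrite (subsetP sY).
  apply/mnmP=> i; rewrite mnm0E; apply/eqP; rewrite -[_ == _]negbK.
  by have /setP/(_ (enum_val i)) := m0; rewrite !inE enum_valK => ->.
have dYX : [disjoint Y & X] by rewrite disjoint_sym.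
(* The face [X] forces rank at least 2, so there are two parameters to play against each other. *)
have sz2 : (1 < size theta)%N.
  rewrite sz_theta; apply: leq_trans X2 _.
  by apply: (leq_bigmax_cond (F := fun E : {set T} => #|E|)); rewrite DE subxx.
case: theta sz2 hom_theta reg_theta {sz_theta} => [|t [|t' theta]] // _ hom_theta reg.
have const0 f : f \in [:: t, t' & theta] -> f@_0%MM = 0.
  move=> /hom_theta[e e0 /dhomog_nemf_coeff]; apply.
  by change (mdeg (0%MM : 'X_{1..#|T|}) != e); rewrite mdeg0 eq_sym -lt0n.
have t0 := const0 t (mem_head _ _).
have t'0 : t'@_0%MM = 0 by apply: const0; rewrite !inE eqxx orbT.
have restr_var (Z : {set T}) v : v \notin Z -> restr Z (var k v) = 0.
  by move=> nZv; rewrite /var restrX mnm_supp1 sub1set (negPf nZv).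
have var_notin v : v \in X :|: Y -> ~ face_ideal D (var k v).
  move=> XYv /(_ U_(enum_rank v)%MM); rewrite mcoeffX eqxx mnm_supp1 DE !sub1set.
  by rewrite -in_setU => /(_ XYv)/eqP; rewrite oner_eq0.
have reg0 f : face_ideal D (t * f) -> face_ideal D f.
  move=> /(face_idealE _ dcD) tf; apply/(face_idealE _ dcD).
  by have := reg 0%N isT f; rewrite /= !cats0; apply.
(* Otherwise [t] would kill a variable of [X], which restricts to 0 on [Y] but is nonzero in the
   quotient. *)
have tX : restr X t != 0.
  have [x Xx] : exists x, x \in X by apply/card_gt0P; apply: ltnW.
  apply/eqP=> tX0; apply: (var_notin x); first by rewrite inE Xx.
  apply: reg0; apply: faceE; rewrite rmorphM /=; first by rewrite tX0 mul0r.
  by rewrite restr_var ?mulr0 // (disjointFr dXY Xx).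
have tY : restr Y t != 0.
  have [y Yy] : exists y, y \in Y by apply/card_gt0P.
  apply/eqP=> tY0; apply: (var_notin y); first by rewrite inE Yy orbT.
  apply: reg0; apply: faceE; rewrite rmorphM /=; last by rewrite tY0 mul0r.
  by rewrite restr_var ?mulr0 // (disjointFl dXY Yy).
have restrK (Z : {set T}) f : restr Z (restr Z f) = restr Z f.
  by apply/mpolyP=> m; rewrite !mcoeff_restr; case: (_ \subset _).
(* Modulo the face ideal, [t'] times [restr X t] equals [restr X t'] times [t]: they agree on [X]
   and both vanish on [Y]. Regularity of [t'] modulo [t] gives the claim. *)
have [u Iu] : ideal_adjoin (face_ideal D) t (restr X t).
  have : ideal_adjoin (in_ideal (sr_gens k D)) t (restr X t).
    apply/in_ideal_rcons; rewrite -cats1; apply: (reg 1%N isT) => /=.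
    rewrite cats1; apply/in_ideal_rcons; exists (restr X t').
    apply/(face_idealE _ dcD); apply: faceE; rewrite rmorphB !rmorphM /= ?restrK.
      by rewrite mulrC subrr.
    by rewrite !restr_disj // mulr0 mul0r subr0.
  by case=> u /(face_idealE _ dcD); exists u.
have uX : restr X u = 1.
  apply: (mulIf tX); rewrite mul1r; apply/esym/eqP; rewrite -subr_eq0.
  by have := faceX _ Iu; rewrite rmorphB rmorphM /= restrK => ->.
have uY : restr Y u = 0.
  apply: (mulIf tY); rewrite mul0r; apply/eqP; rewrite -oppr_eq0.
  by have := faceY _ Iu; rewrite rmorphB rmorphM /= restr_disj // sub0r => ->.
have := mcoeff_restr X u 0; have := mcoeff_restr Y u 0.
rewrite uX uY mnm_supp0 !sub0set mcoeff0 mcoeff1 eqxx => <- /eqP.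
by rewrite oner_eq0.
Qed.
End DisjointSimplices.

(** * Links in blow-ups *)

Section Blowups.
Variables (k : fieldType) (G : sgraph) (d : nat) (x y : 'I_d -> G).
Hypothesis xy_mac : macaulay_order x y.

Lemma macaulay_adj_trans i j l :
  adj (x i) (y j) -> adj (x j) (y l) -> adj (x i) (y l).
Proof.
case: xy_mac => [[_ _ diag trans] _].
have [<-//|nij] := eqVneq i j; have [<-//|njl] := eqVneq j l.
by have [<-//|nil] := eqVneq i l; apply: trans nij njl nil.
Qed.

Lemma macaulay_adj_diag i : adj (x i) (y i).
Proof. by case: xy_mac => [[]]. Qed.

Variable n : 'I_d -> nat.
Local Notation J := {i : 'I_d & 'I_(n i)}.
Local Notation B := (blowup x y n).
Definition blowup_x (a : J) : B := inl a.
Definition blowup_y (a : J) : B := inr a.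

Lemma blowup_cover (v : B) : exists a, v = blowup_x a \/ v = blowup_y a.
Proof. by case: v => a; exists a; [left | right]. Qed.

Lemma blowup_pairing : pairing blowup_x blowup_y.
Proof.
split=> //.
- by move=> a b [].
- by move=> a b [].
- by move=> a; apply: macaulay_adj_diag.
- by move=> a b c; apply: macaulay_adj_trans.
Qed.

Lemma blowup_pure : pure (Ind B).
Proof.
have card F : F \in facets (Ind B) -> #|F| = #|{: J}|.
  exact: (card_facet_paired blowup_pairing blowup_cover).
by move=> E F /card-> /card->.
Qed.

Lemma card_blowup_index : #|{: J}| = \sum_(i < d) n i.
Proof.
rewrite card_tagged sumnE big_map big_enum.
by apply: eq_bigr => i _; rewrite card_ord.
Qed.

Lemma card_blowup_block i0 : #|[set a : J | tag a == i0]| = n i0.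
Proof.
pose in_block (r : 'I_(n i0)) : J := Tagged (fun i => 'I_(n i)) r.
have in_block_inj : injective in_block.
  by move=> r s /eqP; rewrite eq_Tagged => /eqP.
rewrite -[RHS]card_ord -cardsT -(card_imset _ in_block_inj).
apply: eq_card => -[i r]; rewrite inE /=; apply/eqP/imsetP => [ei|[s _ es]].
  by subst i; exists r.
by have := congr1 tag es.
Qed.

Lemma card_blowup_index_neq i0 :
  #|[set a : J | tag a != i0]| = (\sum_(i < d) n i) - n i0.
Proof.
rewrite -card_blowup_index -(card_blowup_block i0) -cardsT.
rewrite -(cardsID [set a : J | tag a == i0] setT) setTI addKn.
by apply: eq_card => a; rewrite !inE andbT.
Qed.

Lemma blowup_link_CM (i0 : 'I_d) (F : {set B}) :
  (forall i, 1 < n i -> n i0 <= n i) -> F \in Ind B ->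
  (\sum_(i < d) n i) - n i0 + 1 <= #|F| -> cohen_macaulay k (link (Ind B) F).
Proof.
move=> min_i0 indF leF; rewrite link_Ind //; move/IndP: indF => indF.
(* Only pairs disjoint from [F] can have a vertex in the link, because a vertex of [F] excludes its
   partner. *)
pose free a := (blowup_x a \notin F) && (blowup_y a \notin F).
set U := [set v | _].
have in_U v : (v \in U) = (v \notin F) && [forall u in F, ~~ adj u v] by rewrite inE.
have U_F v u : v \in U -> u \in F -> ~~ adj u v.
  by rewrite in_U => /andP[_ /forall_inP]; apply.
have xU a : blowup_x a \in U -> free a.
  move=> Ua; rewrite /free; move: (Ua); rewrite in_U => /andP[-> _] /=.
  apply/negP=> Fa; have := U_F _ _ Ua Fa.
  by rewrite [adj _ _]macaulay_adj_diag.
have yU a : blowup_y a \in U -> free a.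
  move=> Ua; rewrite /free; move: (Ua); rewrite in_U => /andP[-> _] /=.
  rewrite andbT; apply/negP=> Fa; have := U_F _ _ Ua Fa.
  by rewrite [adj _ _]macaulay_adj_diag.
have xnU a : free a -> blowup_x a \notin U ->
    exists2 b, blowup_y b \in F & adj (x (tag a)) (y (tag b)).
  case/andP=> nFa _; rewrite in_U nFa /= => /forall_inPn[[b|b] Fb /negPn ab] //.
  by exists b.
have ynU a : free a -> blowup_y a \notin U ->
    exists2 b, blowup_x b \in F & adj (x (tag b)) (y (tag a)).
  case/andP=> _ nFa; rewrite in_U nFa /= => /forall_inPn[[b|b] Fb /negPn ab] //.
  by exists b.
have F_xy a b : blowup_x a \in F -> blowup_y b \in F ->
    ~~ adj (x (tag a)) (y (tag b)).
  exact: indF.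
pose J' := {a : J | free a}.
have PQ : pairing (fun a : J' => blowup_x (val a)) (fun a : J' => blowup_y (val a)).
  have [x_inj y_inj ? ? ? ? trans] := blowup_pairing; split=> //.
  - by move=> a b /x_inj/val_inj.
  - by move=> a b /y_inj/val_inj.
  - by move=> a b c; apply: trans.
apply: (cohen_macaulay_paired k PQ (r := fun a => tag (val a) : nat)); split.
- move=> v Uv; have [a [e|e]] := blowup_cover v; subst v.
    by exists (Sub a (xU _ Uv)); left; rewrite SubK.
  by exists (Sub a (yU _ Uv)); right; rewrite SubK.
(* If [F] blocked both vertices of pair [a], the two blocking vertices of [F] would be adjacent by
   transitivity through [a]. *)
- move=> [a fa] /=; apply: contraT; rewrite negb_or => /andP[nx ny].
  have [b Fb ab] := xnU _ fa nx; have [c Fc ca] := ynU _ fa ny.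
  by have := F_xy _ _ Fc Fb; rewrite (macaulay_adj_trans ca ab).
- move=> [a fa] [b fb] /= Ua Ub ab; apply/andP; split; apply: contraT.
    case/(ynU _ fa) => c Fc ca; have := U_F _ _ Ub Fc.
    by rewrite [adj _ _](macaulay_adj_trans ca ab).
  case/(xnU _ fb) => c Fc bc; have := U_F _ _ Ua Fc.
  by rewrite [adj _ _](macaulay_adj_trans ab bc).
- move=> [a fa] [b fb] /= Ua Ub ab; rewrite -val_eqE /= => nab.
  (* The strict order can fail only for distinct [a], [b] in one block. Then [F] misses that whole
     block, which has size at least [n i0], and [F] is too small. *)
  have := xy_mac.2 _ _ ab; rewrite leq_eqVlt => /predU1P[/val_inj eab|//].
  have n2 : 1 < n (tag a).
    rewrite ltnNge; apply: contra nab => n1.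
    case: a b eab {fa fb Ua Ub ab} n1 => [i r] [j s] /= eij; subst j => n1.
    apply/eqP; congr Tagged; apply: ord_inj; move: (ltn_ord r) (ltn_ord s); lia.
  have := min_i0 _ n2.
  have sF c : blowup_x c \in F -> tag c != tag a.
    move=> Fc; apply/eqP=> eca; have := U_F _ _ Ub Fc.
    by rewrite [adj _ _](_ : _ = adj (x (tag c)) (y (tag b))) // eca eab macaulay_adj_diag.
  have sF' c : blowup_y c \in F -> tag c != tag a.
    move=> Fc; apply/eqP=> eca; have := U_F _ _ Ua Fc.
    by rewrite [adj _ _](_ : _ = adj (x (tag a)) (y (tag c))) // eca macaulay_adj_diag.
  pose h c := if blowup_x c \in F then blowup_x c else blowup_y c.
  have : #|F| <= #|[set c : J | tag c != tag a]|.
    apply: leq_trans (leq_imset_card h _); apply/subset_leq_card/subsetP=> v Fv.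
    apply/imsetP; have [c [e|e]] := blowup_cover v; subst v; exists c.
    + by rewrite inE sF.
    + by rewrite /h Fv.
    + by rewrite inE sF'.
    + rewrite /h; case: ifP => // Fc; have := F_xy _ _ Fc Fv.
      by rewrite macaulay_adj_diag.
  rewrite card_blowup_index_neq.
  have : n (tag a) <= \sum_(i < d) n i by rewrite (bigD1 (tag a)) //= leq_addr.
  lia.
Qed.

Lemma blowup_link_not_CM (i0 : 'I_d) : 1 < n i0 ->
  exists F : {set B}, [/\ F \in Ind B, (\sum_(i < d) n i) - n i0 <= #|F|
    & ~ cohen_macaulay k (link (Ind B) F)].
Proof.
move=> n2.
(* Edges go from [x i] to [y j] only for [i <= j], so late [x] and early [y] are independent. They
   exclude their own partners and leave exactly the block of [i0] in the link. *)
pose h (a : J) := if i0 < tag a then blowup_x a else blowup_y a.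
pose F := h @: [set a : J | tag a != i0].
have h_inj : injective h.
  by move=> a b; rewrite /h; case: ifP => _; case: ifP => _ // [].
have xF a : (blowup_x a \in F) = (i0 < tag a).
  apply/imsetP/idP => [[b _]|lt_a]; first by rewrite /h; case: ifP => // ? [->].
  by exists a; rewrite ?inE /h ?lt_a //; apply: contraTneq lt_a => ->; rewrite ltnn.
have yF a : (blowup_y a \in F) = (tag a < i0).
  apply/imsetP/idP => [[b]|lt_a].
    rewrite inE -val_eqE /= /h; case: ltngtP => // lt_b _ [e].
    by rewrite e.
  exists a; rewrite ?inE /h; first by apply: contraTneq lt_a => ->; rewrite ltnn.
  by rewrite ltnNge (ltnW lt_a).
have le_adj i j : adj (x i) (y j) -> i <= j by apply: xy_mac.2.
have indF : F \in Ind B.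
  apply/IndP=> -[a|a] [b|b] //; rewrite ?xF ?yF.
    move=> /= lta ltb; apply/negP=> /le_adj; lia.
  move=> /= lta ltb; apply/negP=> /le_adj; lia.
exists F; split=> //; first by rewrite card_imset // card_blowup_index_neq.
rewrite link_Ind //; set U := [set v | _].
pose block := [set a : J | tag a == i0].
pose X := blowup_x @: block; pose Y := blowup_y @: block.
have xX a : (blowup_x a \in X) = (tag a == i0) by rewrite mem_imset ?inE // => ? ? [].
have yY a : (blowup_y a \in Y) = (tag a == i0) by rewrite mem_imset ?inE // => ? ? [].
have xY a : (blowup_x a \in Y) = false by apply/negbTE/imsetP=> -[].
have yX a : (blowup_y a \in X) = false by apply/negbTE/imsetP=> -[].
have xU a : (blowup_x a \in U) = (tag a == i0).
  rewrite inE xF; apply/andP/eqP=> [[lea /forall_inP nadj]|ea].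
    apply/val_inj/eqP; rewrite eqn_leq [(val _ <= _)%N]leqNgt lea /= leqNgt.
    rewrite -yF; apply/negP=> /nadj.
    by rewrite [adj _ _]macaulay_adj_diag.
  rewrite ea ltnn; split=> //; apply/forall_inP=> -[b|b] //; rewrite yF => ltb.
  by apply/negP=> /le_adj; rewrite ea leqNgt ltb.
have yU a : (blowup_y a \in U) = (tag a == i0).
  rewrite inE yF; apply/andP/eqP=> [[lea /forall_inP nadj]|ea].
    apply/val_inj/eqP; rewrite eqn_leq andbC [(val i0 <= _)%N]leqNgt lea /= leqNgt.
    rewrite -xF; apply/negP=> /nadj.
    by rewrite [adj _ _]macaulay_adj_diag.
  rewrite ea ltnn; split=> //; apply/forall_inP=> -[b|b] //; rewrite xF => ltb.
  by apply/negP=> /le_adj; rewrite ea leqNgt ltb.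
apply: (@not_cohen_macaulay_disjoint_simplices k _ _ X Y).
(* The block is complete bipartite, so an independent set in it lies on one side. *)
- move=> E; apply/Ind_onP/orP=> [[/subsetP sEU indE]|].
    have [/existsP[a Ea]|/existsPn noX] := boolP [exists a, blowup_x a \in E].
      left; apply/subsetP=> -[b|b] Eb; first by rewrite xX -xU sEU.
      have := indE _ _ Ea Eb; rewrite [adj _ _](_ : _ = adj (x (tag a)) (y (tag b))) //.
      have /eqP-> : tag a == i0 by rewrite -xU sEU.
      have /eqP-> : tag b == i0 by rewrite -yU sEU.
      by rewrite macaulay_adj_diag.
    right; apply/subsetP=> -[b|b] Eb; last by rewrite yY -yU sEU.
    by case/negP: (noX b).
  case=> /subsetP sE; split.
  + by apply/subsetP=> -[b|b] /sE; rewrite ?yX // xX xU.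
  + by move=> [b|b] [c|c] /sE // + /sE; rewrite ?yX.
  + by apply/subsetP=> -[b|b] /sE; rewrite ?xY // yY yU.
  + by move=> [b|b] [c|c] /sE // + /sE; rewrite ?xY.
- apply/pred0P=> -[a|a] /=; first by rewrite [X in _ && X]xY andbF.
  by rewrite [X in X && _]yX.
- by rewrite card_imset ?card_blowup_block // => ? ? [].
- by rewrite card_imset ?card_blowup_block ?(ltnW n2) // => ? ? [].
Qed.
End Blowups.

(** * Graphs with a Macaulay order *)

Section MacaulayOrders.
Variables (H : sgraph) (d : nat) (x y : 'I_d -> H).
Hypothesis xy_mac : macaulay_order x y.

Lemma macaulay_cover v : exists i, v = x i \/ v = y i.
Proof.
case: xy_mac => [[[g _ gK] _ _ _] _].
by rewrite -(gK v); case: (g v) => i; exists i; [left | right].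
Qed.

Lemma macaulay_pairing : pairing x y.
Proof.
have [[bij_xy adjN _ _] _] := xy_mac; have xy_inj := bij_inj bij_xy.
split=> [i j e|i j e|i j|i j|i j|j|i j l].
- by have [] := xy_inj (inl i) (inl j) e.
- by have [] := xy_inj (inr i) (inr j) e.
- by apply/eqP=> e; have := xy_inj (inl i) (inr j) e.
- by case: (adjN i j).
- by case: (adjN i j).
- exact: macaulay_adj_diag xy_mac j.
- exact: macaulay_adj_trans xy_mac i j l.
Qed.

Lemma macaulay_graph_CM (k : fieldType) : graph_CM k H.
Proof.
rewrite /graph_CM -Ind_on_setT.
apply: (cohen_macaulay_paired k macaulay_pairing (r := fun i => i : nat)); split.
- by move=> v _; apply: macaulay_cover.
- by move=> j; rewrite inE.
- by move=> i j; rewrite !inE.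
- by move=> i j _ _ /xy_mac.2; rewrite ltn_neqAle => -> nij; rewrite andbT.
Qed.

Lemma macaulay_bipartite : bipartite H.
Proof.
exists [set x i | i in 'I_d] => u v uv.
have PQ := macaulay_pairing.
have in_x i : x i \in [set x i | i in 'I_d] by apply: imset_f.
have in_y i : (y i \in [set x i | i in 'I_d]) = false.
  by apply/imsetP=> -[j _ /esym/eqP]; rewrite (negPf (pairing_neq PQ _ _)).
have [i [e|e]] := macaulay_cover u; have [j [e'|e']] := macaulay_cover v;
  subst u v; rewrite ?in_x ?in_y //.
- by rewrite (negPf (pairing_adjll PQ _ _)) in uv.
- by rewrite (negPf (pairing_adjrr PQ _ _)) in uv.
Qed.

Lemma macaulay_twin_free (u v : H) : (forall w, adj u w = adj v w) -> u = v.
Proof.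
have PQ := macaulay_pairing; have [_ le_adj] := xy_mac.
have diag := pairing_adj PQ.
have [i [e|e]] := macaulay_cover u; have [j [e'|e']] := macaulay_cover v;
  subst u v => twins.
- congr x; apply/val_inj/eqP; rewrite eqn_leq !le_adj //; first by rewrite -twins.
  by rewrite twins.
- by have := twins (y i); rewrite diag (negPf (pairing_adjrr PQ _ _)).
- by have := twins (y j); rewrite diag (negPf (pairing_adjrr PQ _ _)).
- congr y; apply/val_inj/eqP; rewrite eqn_leq !le_adj // adj_sym.
    by rewrite twins adj_sym.
  by rewrite -twins adj_sym.
Qed.

Variable n : 'I_d -> nat.
Hypothesis n_gt0 : forall i, 0 < n i.

(** [emb] sends a vertex to its copy number 0, which exists since [n i] is positive, and [proj]
    forgets the copy. They serve to compare two graphs with a common blow-up. *)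
Lemma blowup_retract :
  exists (emb : H -> blowup x y n) (proj : blowup x y n -> H),
  (forall u v, adj (emb u) (emb v) = adj u v) /\
  (forall u v, adj (proj u) (proj v) = adj u v).
Proof.
have PQ := macaulay_pairing.
have [[[g xyK gK] _ _ _] _] := xy_mac.
pose tag0 i : {i : 'I_d & 'I_(n i)} :=
  Tagged (fun i => 'I_(n i)) (Ordinal (n_gt0 i)).
exists (fun u =>
  match g u with inl i => inl (tag0 i) | inr i => inr (tag0 i) end).
exists (fun u => match u with inl a => x (tag a) | inr a => y (tag a) end).
split=> u v; last first.
  case: u v => [a|a] [b|b] //=; rewrite ?(negPf (pairing_adjll PQ _ _)) //.
    by rewrite adj_sym.
  by rewrite (negPf (pairing_adjrr PQ _ _)).
rewrite -{2}(gK u) -{2}(gK v); case: (g u) (g v) => [i|i] [j|j] //=.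
- by rewrite (negPf (pairing_adjll PQ _ _)).
- by rewrite adj_sym.
- by rewrite (negPf (pairing_adjrr PQ _ _)).
Qed.
End MacaulayOrders.

(** Embedding into one blow-up, passing through [G] and projecting from the other preserves and
    reflects adjacency. Such a map is injective on a twin-free graph; injections both ways between
    finite sets are bijections. *)
Lemma blowup_iso_inj (G H H' : sgraph) (d d' : nat) (x y : 'I_d -> H)
    (x' y' : 'I_d' -> H') (n : 'I_d -> nat) (n' : 'I_d' -> nat) :
  macaulay_order x y -> macaulay_order x' y' ->
  (forall i, 0 < n i) -> (forall i, 0 < n' i) ->
  graph_iso G (blowup x y n) -> graph_iso G (blowup x' y' n') -> graph_iso H H'.
Proof.
move=> mac mac' n0 n0' [f [[g fK gK] adj_f]] [f' [[g' f'K g'K] adj_f']].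
have adj_g u v : adj (g u) (g v) = adj u v by rewrite -adj_f !gK.
have adj_g' u v : adj (g' u) (g' v) = adj u v by rewrite -adj_f' !g'K.
have [emb [proj [adj_emb adj_proj]]] := blowup_retract mac n0.
have [emb' [proj' [adj_emb' adj_proj']]] := blowup_retract mac' n0'.
pose phi u := proj' (f' (g (emb u))).
pose psi u := proj (f (g' (emb' u))).
have adj_phi u v : adj (phi u) (phi v) = adj u v.
  by rewrite adj_proj' adj_f' adj_g adj_emb.
have adj_psi u v : adj (psi u) (psi v) = adj u v.
  by rewrite adj_proj adj_f adj_g' adj_emb'.
have phi_inj : injective phi.
  move=> u v e; apply: (macaulay_twin_free mac) => w.
  by rewrite -adj_phi e adj_phi.
have psi_inj : injective psi.
  move=> u v e; apply: (macaulay_twin_free mac') => w.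
  by rewrite -adj_psi e adj_psi.
exists phi; split=> //; apply: inj_card_bij phi_inj _.
exact: leq_card psi_inj.
Qed.

(** * Pure bipartite graphs *)

Section Hall.
Variables (T : finType) (e : rel T).
Implicit Types A B S : {set T}.

Definition nbrs B S := [set b in B | [exists a in S, e a b]].

Lemma nbrsU B S S' : nbrs B (S :|: S') = nbrs B S :|: nbrs (B :\: nbrs B S) S'.
Proof.
apply/setP=> b; rewrite !inE; case: (b \in B) => //=; rewrite andbT.
apply/exists_inP/orP=> [[a]|].
  rewrite inE => /orP[Sa ab|Sa ab]; first by left; apply/exists_inP; exists a.
  by have [_|_] := boolP [exists a in S, e a b]; [left | right];
    rewrite //=; apply/exists_inP; exists a.
case=> [/exists_inP[a Sa ab]|/andP[_ /exists_inP[a Sa ab]]];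
  by exists a; rewrite // inE Sa ?orbT.
Qed.

(** Halmos-Vaughan induction on [#|A|]. A tight proper subset splits the problem into itself and its
    complement; without one, any edge can be matched first, as every other nonempty proper subset
    has a neighbour to spare. *)
Lemma hall_marriage A B :
  (forall S, S \subset A -> #|S| <= #|nbrs B S|) ->
  exists2 f : T -> T, {in A &, injective f}
    & forall a, a \in A -> f a \in B /\ e a (f a).
Proof.
have [n] := ubnP #|A|; elim: n A B => // n IHn A B ltAn hallA.
have [A0|[a Aa]] := set_0Vmem A.
  by exists id => // a; rewrite A0 inE.
pose tight S := [&& S != set0, S \proper A & #|nbrs B S| == #|S|].
have [/existsP[S /and3P[S0 pSA /eqP tS]]|/existsPn loose] := boolP [exists S, tight S].
  have sSA := proper_sub pSA.
  have [|S' sS'S|f f_inj fP] := IHn S B.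
  - exact: leq_trans (proper_card pSA) _.
  - by apply: hallA; apply: subset_trans sSA.
  have [|S' sS'D|g g_inj gP] := IHn (A :\: S) (B :\: nbrs B S).
  - rewrite cardsDS //; move: ltAn S0 (subset_leq_card sSA).
    by rewrite -card_gt0; lia.
  - have := hallA (S :|: S'); rewrite subUset sSA nbrsU.
    move=> /(_ (subset_trans sS'D (subsetDl _ _))).
    have dS : S :&: S' = set0.
      apply/setP=> b; rewrite !inE; apply/negP=> /andP[Sb /(subsetP sS'D)].
      by rewrite inE Sb.
    rewrite !cardsU dS cards0 subn0 tS; lia.
  exists (fun b => if b \in S then f b else g b).
    have fg_neq b c : b \in S -> c \in A :\: S -> f b != g c.
      move=> Sb Dc; apply/eqP=> efg; have [fB fe] := fP _ Sb.
      have [+ _] := gP _ Dc; rewrite -efg !inE fB /= andbT => /negP; apply.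
      by apply/exists_inP; exists b.
    move=> b c Ab Ac; case: ifPn => Sb; case: ifPn => Sc.
    - exact: f_inj.
    - by move/eqP; rewrite (negPf (fg_neq _ _ _ _)) // inE Sc.
    - by move/esym/eqP; rewrite (negPf (fg_neq _ _ _ _)) // inE Sb.
    - by apply: g_inj; rewrite inE ?Sb ?Sc.
  move=> b Ab; case: ifPn => Sb; first exact: fP.
  have [|+ eb] := gP b; first by rewrite inE Sb.
  by rewrite inE => /andP[].
have /card_gt0P[b] : 0 < #|nbrs B [set a]|.
  by apply: leq_trans (hallA _ _); rewrite ?cards1 ?sub1set.
rewrite inE => /andP[Bb /exists_inP[_ /set1P-> ab]].
have [|S sSD|f f_inj fP] := IHn (A :\ a) (B :\ b).
- by move: ltAn; rewrite (cardsD1 a) Aa.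
- have [->|S0] := eqVneq S set0; first by rewrite cards0.
  have pSA : S \proper A.
    apply: sub_proper_trans sSD _; exact: properD1.
  have := loose S; rewrite /tight S0 pSA /= => nt.
  have := hallA _ (proper_sub pSA).
  have : nbrs B S \subset b |: nbrs (B :\ b) S.
    by apply/subsetP=> c; rewrite !inE; case: eqP.
  move/subset_leq_card; rewrite cardsU1 => H1.
  have : #|nbrs B S| <= 1 + #|nbrs (B :\ b) S|.
    by apply: leq_trans H1 _; rewrite leq_add2r leq_b1.
  move: nt; lia.
exists (fun c => if c == a then b else f c).
  have fb c : c \in A -> c != a -> f c != b.
    move=> Ac nca; have [|+ _] := fP c; first by rewrite !inE nca.
    by rewrite !inE => /andP[].
  move=> c c' Ac Ac'; case: eqVneq => [->|nca]; case: eqVneq => [->|nc'a] //.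
  - by move/esym/eqP; rewrite (negPf (fb _ Ac' nc'a)).
  - by move/eqP; rewrite (negPf (fb _ Ac nca)).
  - by apply: f_inj; rewrite !inE ?nca ?nc'a.
move=> c Ac; case: eqVneq => [->|nca] //.
have [|+ ec] := fP c; first by rewrite !inE nca.
by rewrite !inE => /andP[].
Qed.
End Hall.

(** * From purity to a pairing *)

Lemma pure_Ind_card (G : sgraph) (A E : {set G}) : pure (Ind G) ->
  A \in facets (Ind G) -> E \in Ind G ->
  exists2 F : {set G}, F \in Ind G & E \subset F /\ #|F| = #|A|.
Proof.
move=> pureG facA indE; have [F maxF sEF] := maxset_exists indE.
exists F; first exact: maxsetp maxF.
by split=> //; apply: pureG => //; rewrite in_set.
Qed.

Lemma bipartition_facet (G : sgraph) (A : {set G}) : no_isolated G ->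
  (forall u v, adj u v -> (u \in A) != (v \in A)) -> A \in facets (Ind G).
Proof.
move=> isoG bipA; rewrite in_set; apply/maxsetP; split.
  apply/IndP=> u v Au Av; apply/negP=> /bipA.
  by rewrite Au Av.
move=> F /IndP indF sAF; apply/eqP; rewrite eqEsubset sAF andbT.
apply/subsetP=> v Fv; apply/idPn=> nAv; have [u vu] := isoG v.
have Au : u \in A by have := bipA _ _ vu; rewrite (negPf nAv); case: (u \in A).
by have := indF _ _ Fv (subsetP sAF _ Au); rewrite vu.
Qed.

Lemma pure_bipartite_pairing (G : sgraph) : bipartite G -> no_isolated G ->
  pure (Ind G) -> exists (J : finType) (p q : J -> G),
    pairing p q /\ forall v, exists j, v = p j \/ v = q j.
Proof.
case=> A bipA isoG pureG.
have facA := bipartition_facet isoG bipA.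
have facC : ~: A \in facets (Ind G).
  by apply: bipartition_facet => // u v /bipA; rewrite !inE (inj_eq negb_inj).
have cardC : #|~: A| = #|A| by apply: pureG.
have nadjA u v : u \in A -> v \in A -> ~~ adj u v.
  by move=> Au Av; apply/negP=> /bipA; rewrite Au Av.
have nadjC u v : u \notin A -> v \notin A -> ~~ adj u v.
  by move=> nAu nAv; apply/negP=> /bipA; rewrite (negPf nAu) (negPf nAv).
(* Hall's condition: [S] together with its non-neighbours in [~: A] is independent, and purity
   bounds its size [#|S| + (#|A| - #|N|)] by [#|A|]. *)
have [S sSA|f f_inj fP] := @hall_marriage G (@adj G) A (~: A).
  set N := nbrs _ _ _; have sNC : N \subset ~: A.
    by apply/subsetP=> b; rewrite inE => /andP[].
  have indE : S :|: (~: A :\: N) \in Ind G.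
    have SN u v : u \in S -> v \in ~: A :\: N -> ~~ adj u v.
      move=> Su; rewrite !inE => /andP[nNv nAv]; apply: contra nNv => uv.
      by rewrite nAv; apply/exists_inP; exists u.
    apply/IndP=> u v; rewrite ![_ \in _ :|: _]in_setU => /orP[Su|Cu] /orP[Sv|Cv].
    - by apply: nadjA; apply: (subsetP sSA).
    - exact: SN.
    - by rewrite adj_sym SN.
    - by move: Cu Cv; rewrite !inE => /andP[_ +] /andP[_]; apply: nadjC.
  have [F _ [/subset_leq_card]] := pure_Ind_card pureG facA indE.
  have -> : #|S :|: (~: A :\: N)| = #|S| + (#|A| - #|N|).
    rewrite cardsU cardsDS // cardC (_ : S :&: _ = set0) ?cards0 ?subn0 //.
    apply/setP=> v; rewrite !inE; apply/negP=> /and3P[/(subsetP sSA) Av _].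
    by rewrite Av.
  have := subset_leq_card sNC; rewrite cardC; lia.
pose J : finType := {v : G | v \in A}.
pose p (j : J) := val j; pose q (j : J) := f (val j).
have fA j : q j \notin A by have [] := fP _ (valP j); rewrite inE.
have p_inj : injective p by apply: val_inj.
have q_inj : injective q.
  by move=> i j e; apply/val_inj/f_inj => //; apply: valP.
have cover v : exists j, v = p j \/ v = q j.
  have [Av|nAv] := boolP (v \in A); first by exists (Sub v Av); left; rewrite /p SubK.
  have : v \in f @: A.
    suff -> : f @: A = ~: A by rewrite inE.
    apply/eqP; rewrite eqEcard cardC card_in_imset // leqnn andbT.
    by apply/subsetP=> _ /imsetP[a Aa ->]; have [] := fP _ Aa.
  by case/imsetP=> a Aa ->; exists (Sub a Aa); right; rewrite /q SubK.
have adj_pq j : adj (p j) (q j) by have [] := fP _ (valP j).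
exists J, p, q; split=> //; split=> //.
- by move=> i j; apply: contraNneq (fA j) => <-; apply: valP.
- by move=> i j; apply: nadjA; apply: valP.
- by move=> i j; apply: nadjC.
(* Were [p i] and [q l] not adjacent, a facet containing both would avoid [p j], a neighbour of
   [q l], and [q j], a neighbour of [p i]. With at most one vertex from each other pair it would be
   too small. *)
move=> i j l pi_qj pj_ql; apply: contraT => nil.
have indE : [set p i; q l] \in Ind G.
  apply/IndP=> u v; rewrite !inE => /orP[]/eqP-> /orP[]/eqP-> //.
  - by rewrite adj_irr.
  - by rewrite adj_sym.
  - by rewrite adj_irr.
have [F /IndP indF [sEF cardF]] := pure_Ind_card pureG facA indE.
have Fpi : p i \in F by apply: (subsetP sEF); rewrite !inE eqxx.
have Fql : q l \in F by apply: (subsetP sEF); rewrite !inE eqxx orbT.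
pose h a := if p a \in F then p a else q a.
suff : #|F| <= #|[set~ j]|.
  have cardJ : #|J| = #|A| by rewrite card_sig.
  have J_gt0 : 0 < #|J| by apply/card_gt0P; exists j.
  by rewrite cardsC1 cardF -cardJ; case: #|J| J_gt0 => // m _; rewrite ltnn.
apply: leq_trans (leq_imset_card h _); apply/subset_leq_card/subsetP=> v Fv.
apply/imsetP; have [a [e|e]] := cover v; exists a; rewrite ?inE; subst v.
- by apply/eqP=> e; subst a; have := indF _ _ Fv Fql; rewrite pj_ql.
- by rewrite /h Fv.
- by apply/eqP=> e; subst a; have := indF _ _ Fpi Fv; rewrite pi_qj.
- by rewrite /h; case: ifP => // Fpa; have := indF _ _ Fpa Fv; rewrite adj_pq.
Qed.

(** * The quotient of a paired graph by its twin classes *)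

Section TwinQuotient.
Variables (k : fieldType) (G : sgraph) (J : finType) (p q : J -> G).
Hypothesis PQ : pairing p q.
Hypothesis cover : forall v, exists j, v = p j \/ v = q j.

Local Notation le a b := (adj (p a) (q b)).
Let le_refl a : le a a. Proof. exact: pairing_adj PQ a. Qed.
Let le_trans a b c : le a b -> le b c -> le a c.
Proof. exact: pairing_trans PQ a b c. Qed.

Definition twin a b := le a b && le b a.
(** A canonical element of the class: the pick depends only on the class as a predicate. The default
    is never reached, since [twin] is reflexive. *)
Definition rep a := odflt a [pick b | twin a b].

Lemma twin_rep a : twin a (rep a).
Proof. by rewrite /rep; case: pickP => //= _; rewrite /twin le_refl. Qed.

Lemma rep_twin a b : twin a b -> rep a = rep b.
Proof.
move=> /andP[ab ba]; rewrite /rep.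
have e c : twin a c = twin b c.
  apply/andP/andP=> -[h1 h2]; split.
  - exact: le_trans ba h1.
  - exact: le_trans h2 ab.
  - exact: le_trans ab h1.
  - exact: le_trans h2 ba.
rewrite (eq_pick e); case: pickP => //= /(_ b).
by rewrite /twin le_refl.
Qed.

Lemma rep_le a b : le (rep a) (rep b) = le a b.
Proof.
have /andP[a1 a2] := twin_rep a; have /andP[b1 b2] := twin_rep b.
apply/idP/idP => h; first exact: le_trans a1 (le_trans h b2).
exact: le_trans a2 (le_trans h b1).
Qed.

Definition twin_class := {a : J | rep a == a}.

Definition twin_adj (u v : twin_class + twin_class) :=
  match u, v with
  | inl a, inr b | inr b, inl a => le (val a) (val b)
  | _, _ => false
  end.

Lemma twin_adj_sym : ssrbool.symmetric twin_adj.
Proof. by move=> [a|a] [b|b]. Qed.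

Lemma twin_adj_irr : irreflexive twin_adj.
Proof. by move=> [a|a]. Qed.

Definition twin_quotient : sgraph := SGraph twin_adj_sym twin_adj_irr.

Definition height a := #|[set b | le b a]|.

Lemma height_lt a b : le a b -> ~~ le b a -> height a < height b.
Proof.
move=> ab nba; apply: proper_card; apply/properP; split.
  by apply/subsetP=> c; rewrite !inE => /le_trans; apply.
by exists b; rewrite inE.
Qed.

Definition classes : seq twin_class :=
  sort (fun a b => height (val a) <= height (val b)) (enum {: twin_class}).

Definition class_x (i : 'I_(size classes)) : twin_quotient :=
  inl (tnth (in_tuple classes) i).
Definition class_y (i : 'I_(size classes)) : twin_quotient :=
  inr (tnth (in_tuple classes) i).

Lemma classes_uniq : uniq classes. Proof. by rewrite sort_uniq enum_uniq. Qed.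

Lemma tnth_classes_inj : injective (tnth (in_tuple classes)).
Proof. by apply/tuple_uniqP; apply: classes_uniq. Qed.

Lemma twin_quotient_macaulay : macaulay_order class_x class_y.
Proof.
have t_inj := tnth_classes_inj.
split; first split.
- apply: inj_card_bij => [[i|i] [j|j]|] //.
  + by case=> /t_inj->.
  + by case=> /t_inj->.
  + by rewrite !card_sum card_ord size_sort -cardE leqnn.
- by [].
- by move=> i; apply: le_refl.
- by move=> i j l _ _ _; apply: le_trans.
move=> i j; rewrite [adj _ _]/= => le_ij; rewrite leqNgt; apply/negP=> lt_ji.
(* If [j] comes before [i], its height is at most that of [i], so the relation from [i] to [j]
   cannot be strict. The two are then twins, hence the same representative. *)
have := @sorted_leq_nth _ (fun a b : twin_class => height (val a) <= height (val b)).
move=> /(_ (fun a b c => @leq_trans _ _ _) (fun a => leqnn _)).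
move=> /(_ (tnth (in_tuple classes) i) classes).
rewrite sort_sorted; last by move=> a b; apply: leq_total.
move=> /(_ isT j i); rewrite !inE !ltn_ord => /(_ isT isT (ltnW lt_ji)).
rewrite -!(tnth_nth _ (in_tuple classes)) leqNgt; case/negP.
apply: height_lt => //; apply: contraL lt_ji => le_ji.
suff -> : i = j by rewrite ltnn.
apply: t_inj; apply: val_inj.
rewrite -(eqP (valP (tnth (in_tuple classes) i))).
rewrite -(eqP (valP (tnth (in_tuple classes) j))).
by apply: rep_twin; rewrite /twin le_ij.
Qed.

Definition class_set (i : 'I_(size classes)) : {set J} :=
  [set a | rep a == val (tnth (in_tuple classes) i)].

Lemma class_setP a : exists i, a \in class_set i.
Proof.
have rr : rep (rep a) == rep a by rewrite -(rep_twin (twin_rep a)).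
pose c : twin_class := exist _ (rep a) rr.
have : c \in in_tuple classes by rewrite mem_sort mem_enum.
by case/tnthP=> i e; exists i; rewrite inE -e.
Qed.

Lemma class_set_gt0 i : 0 < #|class_set i|.
Proof.
apply/card_gt0P; exists (val (tnth (in_tuple classes) i)); rewrite inE.
exact: (valP (tnth (in_tuple classes) i)).
Qed.

Lemma twin_quotient_blowup :
  graph_iso G (blowup class_x class_y (fun i => #|class_set i|)).
Proof.
pose B := blowup class_x class_y (fun i => #|class_set i|).
(* Copy [r] of class [i] becomes the [r]-th element of that class, which matches the blow-up indices
   with [J]. *)
pose elt (a : {i : 'I_(size classes) & 'I_#|class_set i|}) : J := enum_val (tagged a).
have rep_elt a : rep (elt a) = val (tnth (in_tuple classes) (tag a)).
  by have := enum_valP (tagged a); rewrite inE => /eqP.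
have elt_inj : injective elt.
  move=> a b e; have etag : tag a = tag b.
    by apply/tnth_classes_inj/val_inj; rewrite -!rep_elt e.
  case: a b etag e => [i r] [j s] /= ij; subst j => /enum_val_inj /= rs.
  by rewrite rs.
have elt_surj a : exists b, a = elt b.
  have [i ai] := class_setP a.
  exists (Tagged (fun i => 'I_#|class_set i|) (enum_rank_in ai a)).
  by rewrite /elt /= enum_rankK_in.
pose g (u : B) : G := match u with inl a => p (elt a) | inr a => q (elt a) end.
have adj_g u v : adj (g u) (g v) = adj u v.
  have key a b : le (elt a) (elt b) =
      le (val (tnth (in_tuple classes) (tag a)))
         (val (tnth (in_tuple classes) (tag b))).
    by rewrite -!rep_elt rep_le.
  case: u v => [a|a] [b|b] /=.
  - by rewrite (negPf (pairing_adjll PQ _ _)).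
  - exact: key.
  - by rewrite adj_sym; apply: key.
  - by rewrite (negPf (pairing_adjrr PQ _ _)).
have g_inj : injective g.
  move=> [a|a] [b|b] /= e.
  - by congr inl; apply/elt_inj/(pairing_injl PQ).
  - by move/eqP: e; rewrite (negPf (pairing_neq PQ _ _)).
  - by move/esym/eqP: e; rewrite (negPf (pairing_neq PQ _ _)).
  - by congr inr; apply/elt_inj/(pairing_injr PQ).
have [f fK gK] : bijective g.
  apply: inj_card_bij => //; rewrite -(card_codom g_inj).
  apply/subset_leq_card/subsetP=> v _.
  have [j [->|->]] := cover v; have [b ->] := elt_surj j; apply/codomP.
    by exists (inl b).
  by exists (inr b).
exists f; split=> [|u v]; first by exists g.
by rewrite -adj_g !gK.
Qed.

(** If all classes were singletons, the preorder would be antisymmetric and [height] strictly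
    increasing along edges between distinct pairs; [G] itself would then be Cohen-Macaulay. *)
Lemma large_twin_class : ~ graph_CM k G -> exists i, 2 <= #|class_set i|.
Proof.
move=> notCM; apply/existsP; apply: contra_notT notCM => /existsPn small.
rewrite /graph_CM -Ind_on_setT.
apply: (cohen_macaulay_paired k PQ (r := height)); split.
- by move=> v _; apply: cover.
- by move=> j; rewrite inE.
- by move=> i j; rewrite !inE.
move=> a b _ _ ab nab; apply: height_lt => //; apply/negP=> ba.
have [i ai] := class_setP a; have := small i; rewrite -ltnNge ltnS.
apply/negP; rewrite -ltnNge; apply/card_gt1P; exists a, b; split=> //.
by rewrite inE -(@rep_twin a b) ?/twin ?ab //; rewrite inE in ai.
Qed.
End TwinQuotient.

Theorem theorem4p4 (k : fieldType) :
  (forall (G : sgraph) (d : nat) (x y : 'I_d -> G) (n : 'I_d -> nat)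
          (i0 : 'I_d),
     bipartite G ->
     graph_CM k G ->
     macaulay_order x y ->
     (forall i, 0 < n i) ->
     (* n i0 = min {n i | 1 < n i} *)
     1 < n i0 ->
     (forall i, 1 < n i -> n i0 <= n i) ->
     graph_CMt k ((\sum_(i < d) n i) - n i0 + 1) (blowup x y n) /\
     ~ graph_CMt k ((\sum_(i < d) n i) - n i0) (blowup x y n))
  /\
  (forall (G : sgraph) (t : nat),
     bipartite G ->
     no_isolated G ->
     graph_CMt k t G ->
     ~ graph_CM k G ->
     exists H : sgraph,
       [/\ bipartite H, graph_CM k H, obtained_by_replacement G H
         & forall H' : sgraph, bipartite H' -> graph_CM k H' ->
             obtained_by_replacement G H' -> graph_iso H H']).
Proof.
split=> [G d x y n i0 _ _ mac n_gt0 n_gt1 min_i0|G t bipG isoG [pureG _] notCM].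
  split; first split.
  - exact: blowup_pure mac n.
  - by move=> F indF leF; apply: blowup_link_CM min_i0 indF leF.
  - case=> _ CM; have [F [indF leF notCM]] := blowup_link_not_CM k mac n_gt1.
    exact/notCM/CM.
have [J [p [q [PQ cover]]]] := pure_bipartite_pairing bipG isoG pureG.
have mac := twin_quotient_macaulay PQ; have iso := twin_quotient_blowup PQ cover.
have n_gt0 := @class_set_gt0 G J p q.
exists (twin_quotient p q); split.
- exact: macaulay_bipartite mac.
- exact: macaulay_graph_CM mac k.
- exists _, (@class_x G J p q), (@class_y G J p q), (fun i => #|class_set i|).
  by split=> //; apply: large_twin_class PQ cover notCM.
- move=> H' _ _ [d' [x' [y' [n' [mac' n'_gt0 _ iso']]]]].
  exact: blowup_iso_inj mac mac' n_gt0 n'_gt0 iso iso'.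
Qed.
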